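(* Assume the standing assumptions in the context hold and that the event-triggering thresholds satisfy $\sum_{t=0}^\infty(\eta^t)^2<\infty$. Let $\{(\mathbf x^t,\mathbf v^t)\}$ be generated by the AdaDQN algorithm (see context). If the stepsize satisfies $$0<\alpha\le\min\left\{\frac1{2\Gamma L},\ \frac{\psi}{L\Psi^2},\ \frac{\psi}{16\Gamma^2\mathcal C_{net}}\right\},$$ where $\Gamma=\gamma+4\Psi$ and $$\mathcal C_{net}=L+\frac{2L^2}{n(1-\sigma^{2K_c})}+\frac{288(1+\sigma^{2K_c})L^2}{n(1-\sigma^{2K_c})^3}+2n\sigma^{2K_c}\left(\frac{1+\sigma^{2K_c}}{1-\sigma^{2K_c}}\right)+\frac7{24}n\sigma^{2K_c}(1-\sigma^{2K_c}),$$ then for every integer $T\ge1$, $$\min_{0\le t\le T-1}\left\{\|\mathbf v^t\|^2+\|\mathbf v^t-\mathbf M\mathbf v^t\|^2+\|\mathbf x^t-\mathbf M\mathbf x^t\|^2\right\}\le\frac{P(\mathbf x^0,\mathbf v^0)-\underline F+\Theta_T}{\widehat C\,T},$$ where $\Theta_T=(\theta_1+\theta_2)\sum_{t=0}^{T-1}(\eta^t)^2$ with $$\theta_1=8\left(\frac{1+\sigma^{2K_c}}{1-\sigma^{2K_c}}\right)n\left(\sum_{k=0}^{K_c-1}\sigma^k\tau^{K_c-1-k}\right)^2,$$ $$\theta_2=\frac{(1-\sigma^{2K_c})(1+3\sigma^{2K_c}L^2)}{24L^2}\,n\left(\sum_{k=0}^{K_c-1}\sigma^k\tau^{K_c-1-k}\right)^2,$$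 and $\widehat C=\min\{C_f,C_x,C_v\}>0$ with $$C_f=\frac\alpha n\left[\frac\psi4-\alpha\left(\frac{L\Psi^2}8+\Gamma^2\mathcal C_{net}\right)\right],\quad C_x=\frac{(1-\sigma^{2K_c})(3-2\sigma^{2K_c})}8,\quad C_v=\frac{(1-\sigma^{2K_c})^3}{1152(1+\sigma^{2K_c})L^2}.$$
   Context: Problem and standing assumptions. Let $f_1,\dots,f_n:\mathbb{R}^p\to\mathbb{R}$ be continuously differentiable (possibly nonconvex) and $F(\mathbf{z})=\frac1n\sum_{i=1}^n f_i(\mathbf{z})$. Assume: (i) $F$ is bounded below, $\underline F:=\inf_{\mathbf z}F(\mathbf z)>-\infty$; (ii) each $\nabla f_i$ is Lipschitz continuous with constant $L>0$; (iii) the communication graph $\mathcal{G}=(\{1,\dots,n\},\mathcal{E})$ is fixed, connected and undirected; $\mathcal{N}_i$ denotes the set of neighbors of $i$, including $i$ itself. Mixing matrix. $\tilde{\mathbf W}=[\tilde W_{ij}]\in\mathbb{R}^{n\times n}$ is symmetric, doubly stochastic, with $\tilde W_{ij}>0$ if $j\in\mathcal N_i$ and $\tilde W_{ij}=0$ otherwise. $\mathbf W=\tilde{\mathbf W}\otimes\mathbf I_p$, $\mathbf M=\frac1n\mathbf 1_n\mathbf 1_n^{\sf T}\otimes\mathbf I_p$, and $\sigma$ is the second largest eigenvalue magnitude of $\tilde{\mathbf W}$; it is assumed that $0<\sigma<1$. Notation. For $\mathbf u_1,\dots,\mathbf u_n\in\mathbb R^p$, $\mathbf u=[\mathbf u_1;\dots;\mathbf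 u_n]\in\mathbb R^{np}$ and $\bar{\mathbf u}=\frac1n\sum_i\mathbf u_i$. $\mathbf g_i^t=\nabla f_i(\mathbf x_i^t)$, $\mathbf g_i^{t,k}=\nabla f_i(\mathbf x_i^{t,k})$. $\|\cdot\|$ is the Euclidean norm. Superscripts on $\eta^t$ and $\tau^s$ are sequence indices. AdaDQN algorithm. Parameters: stepsize $\alpha>0$, integers $K_g,K_c\ge1$, $0<l\le u$, $\varrho>0$, $\varepsilon\gg\tilde\varepsilon>0$, $\gamma>0$, nonnegative non-increasing threshold sequences $\{\eta^t\}$, $\{\tau^s\}$. Initialize $\mathbf x_i^0$ arbitrarily, $\mathbf v_i^0=\mathbf g_i^0$, $\mathbf H_i^0=\mathbf I_p$. At iteration $t$, every node $i$ does: 1. $\mathbf x_i^{t,0}=\mathbf x_i^t$, $\mathbf v_i^{t,0}=\mathbf v_i^t$, $\mathbf H_i^{t,0}=\mathbf H_i^t$. 2. For $k=0,\dots,K_g-2$: if $\alpha\|\mathbf H_i^{t,k}\mathbf v_i^{t,k}\|<\max\{\varepsilon\|\mathbf x_i^t-\sum_{j\in\mathcal N_i}\tilde W_{ij}\mathbf x_j^t\|,\tilde\varepsilon\}$ or $\|\mathbf x_i^{t,k}-\mathbf x_i^t\|>\gamma\alpha\|\mathbf v_i^t\|$, then set $(\mathbf x_i^{t,k+1},\mathbf v_i^{t,k+1},\mathbf H_i^{t,k+1})=(\mathbf x_i^{t,k},\mathbf v_i^{t,k},\mathbf H_i^{t,k})$; otherwise set $\mathbf x_i^{t,k+1}=\mathbf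 x_i^{t,k}-\alpha\mathbf H_i^{t,k}\mathbf v_i^{t,k}$, $\mathbf v_i^{t,k+1}=\mathbf v_i^{t,k}+\mathbf g_i^{t,k+1}-\mathbf g_i^{t,k}$, and $\mathbf H_i^{t,k+1}=\mathrm{MBFGS}(\mathbf s,\check{\mathbf y},\Delta\mathbf g)$ with $\mathbf s=\mathbf x_i^{t,k+1}-\mathbf x_i^{t,k}$, $\check{\mathbf y}=\Delta\mathbf g=\mathbf g_i^{t,k+1}-\mathbf g_i^{t,k}$. 3. Mandatory step: $\mathbf x_i^{t,K_g}=\mathbf x_i^{t,K_g-1}-\alpha\mathbf H_i^{t,K_g-1}\mathbf v_i^{t,K_g-1}$. 4. $\mathbf x_i^{t+1}=\mathrm{ETC}(\mathbf x^{t,K_g})_i$; then $\mathbf v_i^{t,K_g}=\mathbf v_i^{t,K_g-1}+\mathbf g_i^{t+1}-\mathbf g_i^{t,K_g-1}$; then $\mathbf v_i^{t+1}=\mathrm{ETC}(\mathbf v^{t,K_g})_i$. 5. $\mathbf H_i^{t+1}=\mathrm{MBFGS}(\mathbf x_i^{t+1}-\mathbf x_i^t,\ \mathbf v_i^{t+1}-\mathbf v_i^t,\ \mathbf g_i^{t+1}-\mathbf g_i^t)$. $\mathrm{ETC}$ (event-triggered communication at iteration $t$): given inputs $\mathbf u_i$, set $\mathbf u_i^0=\hat{\mathbf u}_i^0=\mathbf u_i$; for $s=0,\dots,K_c-1$ set $\mathbf u_i^{s+1}=\mathbf u_i^s-(\hat{\mathbf u}_i^s-\sum_{j\in\mathcal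 N_i}\tilde W_{ij}\hat{\mathbf u}_j^s)$, and $\hat{\mathbf u}_i^{s+1}=\mathbf u_i^{s+1}$ if $\|\mathbf u_i^{s+1}-\hat{\mathbf u}_i^s\|\ge\eta^t\tau^{s+1}$, $\hat{\mathbf u}_i^{s+1}=\hat{\mathbf u}_i^s$ otherwise. Output $\mathbf u_i^{K_c}$. $\mathrm{MBFGS}(\mathbf s,\check{\mathbf y},\Delta\mathbf g)$: if $\mathbf s=0$ return $\mathbf I_p$. Let $B(\mathbf s,\mathbf y)=\frac{\mathbf s^{\sf T}\mathbf y}{\|\mathbf y\|^2}\mathbf I_p-\frac{\mathbf s\mathbf y^{\sf T}+\mathbf y\mathbf s^{\sf T}}{\|\mathbf y\|^2}+2\frac{\mathbf s\mathbf s^{\sf T}}{\mathbf s^{\sf T}\mathbf y}$. If $\mathbf s^{\sf T}\check{\mathbf y}>0$ and all eigenvalues of $B(\mathbf s,\check{\mathbf y})$ lie in $[l,u]$, return $B(\mathbf s,\check{\mathbf y})$; otherwise return $B(\mathbf s,\Delta\mathbf g+h\mathbf s)$ with $h=\varrho+\max\{-\mathbf s^{\sf T}\Delta\mathbf g/\|\mathbf s\|^2,0\}$. Constants: $\psi=\min\{1,l,\frac{\varrho}{2(2L+\varrho)^2}\}$, $\Psi=\max\{1,u,\frac2\varrho\}$ (all matrices generated satisfy $\psi\mathbf I_p\preceq\mathbf H\preceq\Psi\mathbf I_p$). Potential function: $$P(\mathbf x^t,\mathbf v^t)=F(\bar{\mathbf x}^t)+\|\mathbf x^t-\mathbf M\mathbf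 x^t\|^2+\frac{(1-\sigma^{2K_c})^2}{288(1+\sigma^{2K_c})L^2}\|\mathbf v^t-\mathbf M\mathbf v^t\|^2 .$$ *)

(* Defs.v *)
From HB Require Import structures.
From mathcomp Require Import all_boot all_order all_algebra.
From mathcomp Require Import boolp classical_sets reals ereal topology.
From mathcomp Require Import normedtype sequences derive.
From mathcomp Require Import mxtens.

Set Implicit Arguments.
Unset Strict Implicit.
Unset Printing Implicit Defensive.

Import Order.TTheory GRing.Theory Num.Theory.
Import numFieldNormedType.Exports.
Local Open Scope classical_set_scope.
Local Open Scope ring_scope.

(* The norm `|_| that MathComp-Analysis puts on matrices is the sup norm, so
   the Euclidean norm is defined separately. The two norms induce the same
   topology, so [differentiable] and [continuous] are not affected. *)
Definition dot (R : realType) (m : nat) (u v : 'cV[R]_m) : R :=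
  (u^T *m v) 0 0.

Definition l2norm (R : realType) (m : nat) (u : 'cV[R]_m) : R :=
  Num.sqrt (dot u u).

Definition gradient (R : realType) (p : nat) (f : 'cV[R]_p -> R)
    (z : 'cV[R]_p) : 'cV[R]_p :=
  \col_j 'D_(delta_mx j 0) f z.

Definition average_fun (R : realType) (n p : nat)
    (f : 'I_n -> 'cV[R]_p -> R) (z : 'cV[R]_p) : R :=
  n%:R^-1 * \sum_(i < n) f i z.

Definition average (R : realType) (n p : nat) (u : 'I_n -> 'cV[R]_p) :
    'cV[R]_p :=
  n%:R^-1 *: \sum_(i < n) u i.

(* [u_1; ...; u_n], with the index convention of the Kronecker product *t *)
Definition stack (R : realType) (n p : nat) (u : 'I_n -> 'cV[R]_p) :
    'cV[R]_(n * p) :=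
  \col_k u (mxtens_unindex k).1 (mxtens_unindex k).2 0.

Definition averaging_mx (R : realType) (n p : nat) : 'M[R]_(n * p) :=
  (n%:R^-1 *: ((const_mx 1 : 'cV[R]_n) *m (const_mx 1 : 'cV[R]_n)^T))
    *t (1%:M : 'M[R]_p).

Definition neighbors (n : nat) (e : rel 'I_n) (i : 'I_n) : {set 'I_n} :=
  [set j | (j == i) || e i j]%SET.

Definition doubly_stochastic (R : realType) (n : nat) (W : 'M[R]_n) : Prop :=
  [/\ forall i j, 0 <= W i j,
      forall i, \sum_j W i j = 1
    & forall j, \sum_i W i j = 1].

(* [s] lists the eigenvalues of [W] with their multiplicities. For n < 2 the
   only admissible value is 0. *)
Definition second_largest_eigenvalue_magnitude (R : realType) (n : nat)
    (W : 'M[R]_n) (sigma : R) : Prop :=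
  exists s : seq R,
    char_poly W = \prod_(a <- s) ('X - a%:P) /\
    sigma = nth 0 (sort >=%R [seq `|a| | a <- s]) 1.

Record adadqn_params (R : realType) := AdaDQNParams {
  q_alpha : R;
  q_Kg : nat;
  q_Kc : nat;
  q_lbound_eig : R;
  q_ubound_eig : R;
  q_varrho : R;
  q_eps : R;
  q_eps_tilde : R;
  q_gamma : R;
  q_eta : nat -> R;
  q_tau : nat -> R
}.

Definition bfgs_mx (R : realType) (p : nat) (s y : 'cV[R]_p) : 'M[R]_p :=
  (dot s y / l2norm y ^+ 2)%:M
  - (l2norm y ^+ 2)^-1 *: (s *m y^T + y *m s^T)
  + (2 / dot s y) *: (s *m s^T).

Definition mbfgs (R : realType) (p : nat) (q : adadqn_params R)
    (s ycheck dg : 'cV[R]_p) : 'M[R]_p :=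
  if s == 0 then 1%:M
  else if (0 < dot s ycheck) &&
          `[< forall a : R, eigenvalue (bfgs_mx s ycheck) a ->
                q_lbound_eig q <= a <= q_ubound_eig q >]
  then bfgs_mx s ycheck
  else let h := q_varrho q + Num.max (- dot s dg / l2norm s ^+ 2) 0 in
       bfgs_mx s (dg + h *: s).

(* State (u^s, uhat^s) after [s] rounds of event-triggered communication, with
   [eta_t] the threshold of the current iteration. *)
Fixpoint etc_rounds (R : realType) (n p : nat) (e : rel 'I_n) (W : 'M[R]_n)
    (eta_t : R) (tau : nat -> R) (u : 'I_n -> 'cV[R]_p) (s : nat) :
    ('I_n -> 'cV[R]_p) * ('I_n -> 'cV[R]_p) :=
  match s with
  | 0%N => (u, u)
  | s'.+1 =>
    let: (us, uhat) := etc_rounds e W eta_t tau u s' in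
    let us1 := fun i =>
      us i - (uhat i - \sum_(j in neighbors e i) W i j *: uhat j) in
    let uhat1 := fun i =>
      if eta_t * tau s'.+1 <= l2norm (us1 i - uhat i) then us1 i
      else uhat i in
    (us1, uhat1)
  end.

Definition etc (R : realType) (n p : nat) (e : rel 'I_n) (W : 'M[R]_n)
    (q : adadqn_params R) (t : nat) (u : 'I_n -> 'cV[R]_p) :
    'I_n -> 'cV[R]_p :=
  (etc_rounds e W (q_eta q t) (q_tau q) u (q_Kc q)).1.

Record node_state (R : realType) (p : nat) := NodeState {
  pos : 'cV[R]_p;
  dir : 'cV[R]_p;
  hess : 'M[R]_p
}.

(* One of the Kg - 1 optional local steps of a node. [st0] is the state of the
   node at the start of the outer iteration and [d] is its disagreement
   || x_i^t - \sum_(j in N_i) W_ij x_j^t ||. *)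
Definition local_step (R : realType) (p : nat) (q : adadqn_params R)
    (fi : 'cV[R]_p -> R) (d : R) (st0 st : node_state R p) : node_state R p :=
  if (q_alpha q * l2norm (hess st *m dir st) < Num.max (q_eps q * d) (q_eps_tilde q))
     || (q_gamma q * q_alpha q * l2norm (dir st0) < l2norm (pos st - pos st0))
  then st
  else
    let x1 := pos st - q_alpha q *: (hess st *m dir st) in
    let dg := gradient fi x1 - gradient fi (pos st) in
    NodeState x1 (dir st + dg) (mbfgs q (x1 - pos st) dg dg).

Definition adadqn_step (R : realType) (n p : nat) (q : adadqn_params R)
    (f : 'I_n -> 'cV[R]_p -> R) (e : rel 'I_n) (W : 'M[R]_n) (t : nat)
    (S : 'I_n -> node_state R p) : 'I_n -> node_state R p :=
  let d := fun i =>
    l2norm (pos (S i) - \sum_(j in neighbors e i) W i j *: pos (S j)) in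
  let loc := fun i => iter (q_Kg q).-1 (local_step q (f i) (d i) (S i)) (S i) in
  let xK := fun i => pos (loc i) - q_alpha q *: (hess (loc i) *m dir (loc i)) in
  let x1 := etc e W q t xK in
  let vK := fun i =>
    dir (loc i) + gradient (f i) (x1 i) - gradient (f i) (pos (loc i)) in
  let v1 := etc e W q t vK in
  fun i => NodeState (x1 i) (v1 i)
    (mbfgs q (x1 i - pos (S i)) (v1 i - dir (S i))
       (gradient (f i) (x1 i) - gradient (f i) (pos (S i)))).

Fixpoint adadqn (R : realType) (n p : nat) (q : adadqn_params R)
    (f : 'I_n -> 'cV[R]_p -> R) (e : rel 'I_n) (W : 'M[R]_n)
    (x0 : 'I_n -> 'cV[R]_p) (t : nat) : 'I_n -> node_state R p :=
  match t with
  | 0%N => fun i => NodeState (x0 i) (gradient (f i) (x0 i)) 1%:M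
  | t'.+1 => adadqn_step q f e W t' (adadqn q f e W x0 t')
  end.

Definition psi (R : realType) (q : adadqn_params R) (L : R) : R :=
  Num.min 1 (Num.min (q_lbound_eig q) (q_varrho q / (2 * (2 * L + q_varrho q) ^+ 2))).

Definition Psi (R : realType) (q : adadqn_params R) : R :=
  Num.max 1 (Num.max (q_ubound_eig q) (2 / q_varrho q)).

Definition Gamma (R : realType) (q : adadqn_params R) : R :=
  q_gamma q + 4 * Psi q.

Definition C_net (R : realType) (n : nat) (q : adadqn_params R)
    (L sigma : R) : R :=
  let r := sigma ^+ (2 * q_Kc q) in
  L + 2 * L ^+ 2 / (n%:R * (1 - r))
  + 288 * (1 + r) * L ^+ 2 / (n%:R * (1 - r) ^+ 3)
  + 2 * n%:R * r * ((1 + r) / (1 - r))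
  + 7 / 24 * n%:R * r * (1 - r).

(* \sum_(k < Kc) sigma^k tau^(Kc-1-k), where the exponent of tau is an index *)
Definition trigger_sum (R : realType) (q : adadqn_params R) (sigma : R) : R :=
  \sum_(0 <= k < q_Kc q) sigma ^+ k * q_tau q (q_Kc q - 1 - k)%N.

Definition theta1 (R : realType) (n : nat) (q : adadqn_params R)
    (sigma : R) : R :=
  let r := sigma ^+ (2 * q_Kc q) in
  8 * ((1 + r) / (1 - r)) * n%:R * trigger_sum q sigma ^+ 2.

Definition theta2 (R : realType) (n : nat) (q : adadqn_params R)
    (L sigma : R) : R :=
  let r := sigma ^+ (2 * q_Kc q) in
  (1 - r) * (1 + 3 * r * L ^+ 2) / (24 * L ^+ 2) * n%:R
  * trigger_sum q sigma ^+ 2.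

Definition Theta (R : realType) (n : nat) (q : adadqn_params R)
    (L sigma : R) (T : nat) : R :=
  (theta1 n q sigma + theta2 n q L sigma) * \sum_(0 <= t < T) q_eta q t ^+ 2.

Definition C_f (R : realType) (n : nat) (q : adadqn_params R)
    (L sigma : R) : R :=
  q_alpha q / n%:R *
  (psi q L / 4
   - q_alpha q * (L * Psi q ^+ 2 / 8 + Gamma q ^+ 2 * C_net n q L sigma)).

Definition C_x (R : realType) (q : adadqn_params R) (sigma : R) : R :=
  let r := sigma ^+ (2 * q_Kc q) in (1 - r) * (3 - 2 * r) / 8.

Definition C_v (R : realType) (q : adadqn_params R) (L sigma : R) : R :=
  let r := sigma ^+ (2 * q_Kc q) in
  (1 - r) ^+ 3 / (1152 * (1 + r) * L ^+ 2).

Definition C_hat (R : realType) (n : nat) (q : adadqn_params R)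
    (L sigma : R) : R :=
  Num.min (C_f n q L sigma) (Num.min (C_x q sigma) (C_v q L sigma)).

Definition potential (R : realType) (n p : nat) (q : adadqn_params R)
    (f : 'I_n -> 'cV[R]_p -> R) (L sigma : R) (x v : 'I_n -> 'cV[R]_p) : R :=
  let r := sigma ^+ (2 * q_Kc q) in
  let M := averaging_mx R n p in
  average_fun f (average x)
  + l2norm (stack x - M *m stack x) ^+ 2
  + (1 - r) ^+ 2 / (288 * (1 + r) * L ^+ 2)
    * l2norm (stack v - M *m stack v) ^+ 2.

Definition stationarity_measure (R : realType) (n p : nat)
    (x v : 'I_n -> 'cV[R]_p) : R :=
  let M := averaging_mx R n p in
  l2norm (stack v) ^+ 2
  + l2norm (stack v - M *m stack v) ^+ 2
  + l2norm (stack x - M *m stack x) ^+ 2.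

(* Main.v *)
Require Import Defs.
From HB Require Import structures.
From mathcomp Require Import all_boot all_order all_algebra.
From mathcomp Require Import boolp classical_sets reals ereal topology.
From mathcomp Require Import normedtype sequences derive.
From mathcomp Require Import functions mxtens complex spectral ring lra.

(* Write r = sigma^(2 Kc), X = |x - Mx|^2, V = |v - Mv|^2 and N = |v|^2.

   The local phase of node i follows a quasi-Newton descent on
   z |-> f_i z + <v_i - grad f_i x_i, z>, whose gradient at the iterates is
   exactly the tracked direction. Hence its total displacement D_i satisfies
   |D_i| <= alpha Gamma |v_i| and <v_i, D_i> <= - c alpha |v_i|^2.

   Event-triggered communication preserves averages; a symmetric doubly
   stochastic W contracts vectors of zero average by sigma (spectral theorem),
   and untransmitted changes add at most 2 sqrt(n) eta^t sum_k sigma^k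
   tau^(Kc-1-k). Young's inequality turns this into recursions for X and V with
   factor (1 + r)/2. Since the average of v tracks the average gradient, the
   descent lemma for F at the mean closes the system, and the chosen weights
   make the potential decrease by C_f N + C_x X + C_v V up to the summable
   trigger terms. *)

Set Implicit Arguments.
Unset Strict Implicit.
Unset Printing Implicit Defensive.

Import Order.TTheory GRing.Theory Num.Theory.
Import numFieldNormedType.Exports.
Local Open Scope classical_set_scope.
Local Open Scope ring_scope.

(** * Euclidean geometry *)

Section Euclidean.
Variables (R : realType) (m : nat).
Implicit Types (u v w : 'cV[R]_m) (a : R).

Lemma dotE u v : dot u v = \sum_i u i 0 * v i 0.
Proof. by rewrite /dot mxE; apply: eq_bigr => i _; rewrite mxE. Qed.

Lemma dotC u v : dot u v = dot v u.
Proof. by rewrite !dotE; apply: eq_bigr => i _; rewrite mulrC. Qed.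

Lemma dotDl u v w : dot (u + v) w = dot u w + dot v w.
Proof. by rewrite /dot linearD /= mulmxDl mxE. Qed.

Lemma dotZl a u v : dot (a *: u) v = a * dot u v.
Proof. by rewrite /dot linearZ /= -scalemxAl mxE. Qed.

Lemma dotNl u v : dot (- u) v = - dot u v.
Proof. by rewrite -scaleN1r dotZl mulN1r. Qed.

Lemma dotBl u v w : dot (u - v) w = dot u w - dot v w.
Proof. by rewrite dotDl dotNl. Qed.

Lemma dotDr u v w : dot w (u + v) = dot w u + dot w v.
Proof. by rewrite dotC dotDl !(dotC w). Qed.

Lemma dotZr a u v : dot v (a *: u) = a * dot v u.
Proof. by rewrite dotC dotZl dotC. Qed.

Lemma dotNr u v : dot v (- u) = - dot v u.
Proof. by rewrite dotC dotNl dotC. Qed.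

Lemma dotBr u v w : dot w (u - v) = dot w u - dot w v.
Proof. by rewrite dotDr dotNr. Qed.

Lemma dot0l v : dot 0 v = 0.
Proof. by rewrite -(scale0r v) dotZl mul0r. Qed.

Lemma dot_sumr (I : Type) (r : seq I) (P : pred I) (F : I -> 'cV[R]_m) u :
  dot u (\sum_(i <- r | P i) F i) = \sum_(i <- r | P i) dot u (F i).
Proof. by rewrite /dot mulmx_sumr summxE. Qed.

Lemma dotvv_ge0 u : 0 <= dot u u.
Proof. by rewrite dotE sumr_ge0 // => i _; rewrite -expr2 sqr_ge0. Qed.

Lemma dotvv_eq0 u : (dot u u == 0) = (u == 0).
Proof.
apply/eqP/eqP => [|->]; last exact: dot0l.
rewrite dotE => /eqP; rewrite psumr_eq0 => [/allP u0|i _]; last first.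
  by rewrite -expr2 sqr_ge0.
apply/colP => i; rewrite mxE; apply/eqP.
by have := u0 i (mem_index_enum i); rewrite mulf_eq0 orbb.
Qed.

Lemma l2norm_ge0 u : 0 <= l2norm u.
Proof. exact: sqrtr_ge0. Qed.

Lemma sqr_l2norm u : l2norm u ^+ 2 = dot u u.
Proof. by rewrite sqr_sqrtr // dotvv_ge0. Qed.

Lemma l2norm_eq0 u : (l2norm u == 0) = (u == 0).
Proof. by rewrite -dotvv_eq0 -sqr_l2norm sqrf_eq0. Qed.

Lemma l2norm_gt0 u : (0 < l2norm u) = (u != 0).
Proof. by rewrite lt0r l2norm_ge0 andbT l2norm_eq0. Qed.

Lemma dotvv_gt0 u : (0 < dot u u) = (u != 0).
Proof. by rewrite lt0r dotvv_ge0 andbT dotvv_eq0. Qed.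

Lemma cauchy_schwarz u v : dot u v ^+ 2 <= dot u u * dot v v.
Proof.
have [->|v0] := eqVneq v 0; first by rewrite dotC !dot0l expr0n mulr0.
have v_gt0 : 0 < dot v v by rewrite dotvv_gt0.
have := dotvv_ge0 (dot v v *: u - dot u v *: v).
rewrite dotBl !dotBr !dotZl !dotZr (dotC v u).
nra.
Qed.

Lemma normr_dot_le u v : `|dot u v| <= l2norm u * l2norm v.
Proof.
rewrite -(@ler_pXn2r _ 2) ?nnegrE ?mulr_ge0 ?l2norm_ge0 //.
by rewrite real_normK ?num_real // exprMn !sqr_l2norm cauchy_schwarz.
Qed.

Lemma dot_le u v : dot u v <= l2norm u * l2norm v.
Proof. exact: le_trans (ler_norm _) (normr_dot_le u v). Qed.

Lemma l2normD u v : l2norm (u + v) <= l2norm u + l2norm v.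
Proof.
rewrite -(@ler_pXn2r _ 2) ?nnegrE ?addr_ge0 ?l2norm_ge0 //.
rewrite sqrrD !sqr_l2norm dotDl !dotDr (dotC v u).
have := dot_le u v; lra.
Qed.

Lemma l2normZ a u : l2norm (a *: u) = `|a| * l2norm u.
Proof.
by rewrite /l2norm dotZl dotZr mulrA -expr2 sqrtrM ?sqr_ge0 // sqrtr_sqr.
Qed.

Lemma l2normN u : l2norm (- u) = l2norm u.
Proof. by rewrite -scaleN1r l2normZ normrN1 mul1r. Qed.

Lemma l2normB u v : l2norm (u - v) <= l2norm u + l2norm v.
Proof. by rewrite -(l2normN v) l2normD. Qed.

Lemma l2norm_distC u v : l2norm (u - v) = l2norm (v - u).
Proof. by rewrite -l2normN opprB. Qed.

Lemma l2norm0 : l2norm (0 : 'cV[R]_m) = 0.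
Proof. by apply/eqP; rewrite l2norm_eq0. Qed.

Lemma l2norm_le u a : 0 <= a -> dot u u <= a ^+ 2 -> l2norm u <= a.
Proof.
by move=> a0 ua; rewrite -(@ler_pXn2r _ 2) ?nnegrE ?l2norm_ge0 // sqr_l2norm.
Qed.

(** The quadratic form in [(s, t)] obtained from the sum of the squared norms of [s a_i - t b_i] is
    nonnegative; evaluating it at well-chosen points avoids discriminants. *)
Lemma cauchy_schwarz_sum (I : finType) (a b : I -> 'cV[R]_m) :
  (\sum_i dot (a i) (b i)) ^+ 2 <=
  (\sum_i dot (a i) (a i)) * (\sum_i dot (b i) (b i)).
Proof.
set A := \sum_i dot (a i) (a i); set B := \sum_i dot (b i) (b i).
set C := \sum_i _.
have quad (s t : R) : 0 <= s ^+ 2 * A + t ^+ 2 * B - 2 * s * t * C.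
  have -> : s ^+ 2 * A + t ^+ 2 * B - 2 * s * t * C =
      \sum_i dot (s *: a i - t *: b i) (s *: a i - t *: b i).
    rewrite /A /B /C !mulr_sumr -big_split -sumrB; apply: eq_bigr => i _ /=.
    by rewrite dotBl !dotBr !dotZl !dotZr (dotC (b i)); ring.
  by apply: sumr_ge0 => i _; exact: dotvv_ge0.
have B0 : 0 <= B by apply: sumr_ge0 => i _; exact: dotvv_ge0.
have A0 : 0 <= A by apply: sumr_ge0 => i _; exact: dotvv_ge0.
have [B_eq0|B_neq0] := eqVneq B 0; last first.
  (* The choice [s = B], [t = C] leaves [B (A B - C^2) >= 0]. *)
  have := quad B C; have : 0 < B by rewrite lt0r B_neq0.
  nra.
(* With [B = 0] this choice leaves [- C^2 >= 0], so [C = 0]. *)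
have := quad C ((A + 1) / 2); rewrite B_eq0; nra.
Qed.

End Euclidean.

(** * Spectral bounds *)

Lemma char_poly_conj (F : fieldType) (m : nat) (P A : 'M[F]_m) :
  P \in unitmx -> char_poly (invmx P *m A *m P) = char_poly A.
Proof.
move=> Pu; set f := @polyC F.
have conj_mx : char_poly_mx (invmx P *m A *m P) =
    map_mx f (invmx P) *m char_poly_mx A *m map_mx f P.
  rewrite /char_poly_mx mulmxBr mulmxBl !map_mxM.
  rewrite scalar_mxC -[X in _ = X - _]mulmxA -[map_mx f _ *m map_mx f P]map_mxM.
  by rewrite mulVmx // map_mx1 mulmx1.
rewrite /char_poly conj_mx !det_mulmx mulrAC -det_mulmx -map_mxM mulVmx //.
by rewrite map_mx1 det1 mul1r.
Qed.

Section Spectral.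
Variable R : realType.
Local Open Scope sesquilinear_scope.
Local Open Scope complex_scope.

Lemma Re_sum (I : Type) (r : seq I) (P : pred I) (F : I -> R[i]) :
  complex.Re (\sum_(i <- r | P i) F i) = \sum_(i <- r | P i) complex.Re (F i).
Proof. by elim/big_rec2: _ => // i x y _ <-; case: (F i) y => [? ?] [? ?]. Qed.

Lemma Im_sum (I : Type) (r : seq I) (P : pred I) (F : I -> R[i]) :
  complex.Im (\sum_(i <- r | P i) F i) = \sum_(i <- r | P i) complex.Im (F i).
Proof. by elim/big_rec2: _ => // i x y _ <-; case: (F i) y => [? ?] [? ?]. Qed.

(* The rows of [U + 'i V] form a unitary basis of eigenvectors; its real and
   imaginary parts spare us complex numbers from here on. *)
Lemma symmetric_spectral (m : nat) (S : 'M[R]_m) : S^T = S ->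
  exists U V : 'M[R]_m, exists d : 'rV[R]_m,
  [/\ U^T *m U + V^T *m V = 1%:M, U^T *m V = V^T *m U,
      U *m S = diag_mx d *m U, V *m S = diag_mx d *m V
    & char_poly S = \prod_i ('X - (d 0 i)%:P)].
Proof.
move=> S_sym; set C := R[i].
pose A : 'M[C]_m := map_mx (real_complex R) S.
have A_real : A \is a realmx.
  by apply/mxOverP => i j; rewrite mxE; apply/complex_realP; exists (S i j).
have A_herm : A \is hermsymmx.
  apply: realsym_hermsym => //.
  by apply/is_hermitianmxP; rewrite expr0 scale1r map_mx_id // /A map_trmx S_sym.
have A_norm := hermitian_normalmx A_herm.
pose P := spectralmx A; pose D := spectral_diag A.
have AE : A = invmx P *m diag_mx D *m P by apply/orthomx_spectralP.
have Pun : P \is unitarymx by exact: spectral_unitarymx.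
have Pu : P \in unitmx by exact: spectral_unit.
have D_real : D \is a realmx by exact: hermitian_spectral_diag_real.
pose d : 'rV[R]_m := map_mx (@complex.Re R) D.
have Dd : D = map_mx (real_complex R) d.
  by apply/matrixP => i j; rewrite !mxE RRe_real //; exact: (mxOverP D_real).
exists (map_mx (@complex.Re R) P), (map_mx (@complex.Im R) P), d.
(* Entrywise form of [P^* P = 1]: its real part gives the first conjunct, its imaginary part the
   second. *)
have PP k l : \sum_j (P j k)^*%C * P j l = (k == l)%:R.
  have : P^t* *m P = 1%:M by rewrite -invmx_unitary // mulVmx.
  by move=> /matrixP/(_ k l); rewrite !mxE => <-; apply: eq_bigr => j _; rewrite !mxE.
have PA j k : \sum_l P j l * (S l k)%:C = (d 0 j)%:C * P j k.
  have : P *m A = diag_mx D *m P by rewrite AE !mulmxA mulmxV // mul1mx.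
  move=> /matrixP/(_ j k); rewrite mul_diag_mx !mxE RRe_real; last exact: (mxOverP D_real).
  by move=> <-; apply: eq_bigr => l _; rewrite mxE.
split.
- apply/matrixP => k l; rewrite !mxE -big_split /=.
  have /(congr1 (@complex.Re R)) := PP k l; rewrite Re_sum.
  have -> : complex.Re ((k == l)%:R : C) = (k == l)%:R by case: (k == l).
  move=> <-; apply: eq_bigr => j _; rewrite !mxE.
  by case: (P j k) (P j l) => [a b] [a' b'] /=; ring.
- apply/matrixP => k l; rewrite !mxE; apply/eqP; rewrite -subr_eq0 -sumrB.
  have /(congr1 (@complex.Im R)) := PP k l; rewrite Im_sum.
  have -> : complex.Im ((k == l)%:R : C) = 0 by case: (k == l).
  move=> PP0; apply/eqP; rewrite -[RHS]PP0; apply: eq_bigr => j _; rewrite !mxE.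
  by case: (P j k) (P j l) => [a b] [a' b'] /=; ring.
- apply/matrixP => j k; rewrite mul_diag_mx !mxE.
  have /(congr1 (@complex.Re R)) := PA j k; rewrite Re_sum mxE.
  case: (P j k) => a b /=; rewrite mul0r subr0 => <-; apply: eq_bigr => l _.
  by rewrite !mxE; case: (P j l) => a' b' /=; ring.
- apply/matrixP => j k; rewrite mul_diag_mx !mxE.
  have /(congr1 (@complex.Im R)) := PA j k; rewrite Im_sum mxE.
  case: (P j k) => a b /=; rewrite mul0r addr0 => <-; apply: eq_bigr => l _.
  by rewrite !mxE; case: (P j l) => a' b' /=; ring.
- apply: (map_poly_inj (real_complex R)).
  rewrite map_char_poly -/A AE char_poly_conj // char_poly_trig ?diag_mx_is_trig //.
  rewrite rmorph_prod; apply: eq_bigr => i _.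
  by rewrite /= map_polyXsubC mxE eqxx mulr1n Dd mxE.
Qed.

End Spectral.

Section SymmetricMatrix.
Variables (R : realType) (m : nat).

Lemma dot_mulmx (A B : 'M[R]_m) (x y : 'cV[R]_m) :
  dot (A *m x) (B *m y) = (x^T *m (A^T *m B) *m y) 0 0.
Proof. by rewrite /dot trmx_mul !mulmxA. Qed.

(** [x |-> (U x, V x)] is an isometry: the real form of Parseval for the unitary basis. *)
Lemma dot_parseval (U V : 'M[R]_m) : U^T *m U + V^T *m V = 1%:M ->
  forall x y, dot x y =
  \sum_i ((U *m x) i 0 * (U *m y) i 0 + (V *m x) i 0 * (V *m y) i 0).
Proof.
move=> UV x y; rewrite big_split /= -!dotE !dot_mulmx /dot -{1}(mulmx1 x^T) -UV.
by rewrite mulmxDr mulmxDl mxE.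
Qed.

(** In the coordinates [(U x, V x)] the matrix multiplies by the numbers [d 0 i], which are roots of
    the characteristic polynomial and hence lie in [[l, u]]. *)
Lemma symmetric_quadratic_form (S : 'M[R]_m) (l u : R) : S^T = S ->
  (forall a, eigenvalue S a -> l <= a <= u) -> forall x : 'cV[R]_m,
  l * dot x x <= dot x (S *m x) /\ (0 <= l -> l2norm (S *m x) <= u * l2norm x).
Proof.
move=> S_sym S_eig x; have [U [V [d [/dot_parseval dotP _ US VS Schar]]]] :=
  symmetric_spectral S_sym.
have d_bound i : l <= d 0 i <= u.
  apply: S_eig; rewrite eigenvalue_root_char Schar rootE horner_prod.
  by apply/prodf_eq0; exists i; rewrite // !hornerE subrr.
have SU i : (U *m (S *m x)) i 0 = d 0 i * (U *m x) i 0.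
  by rewrite mulmxA US -mulmxA mul_diag_mx mxE.
have SV i : (V *m (S *m x)) i 0 = d 0 i * (V *m x) i 0.
  by rewrite mulmxA VS -mulmxA mul_diag_mx mxE.
split=> [|l_ge0].
  rewrite !dotP mulr_sumr; apply: ler_sum => i _; rewrite SU SV.
  have /andP[ld _] := d_bound i; nra.
(* An index is needed to derive [0 <= u] from [0 <= l]; in dimension 0 the vector itself
   vanishes. *)
have [/existsP[i0 _]|m0] := boolP [exists i : 'I_m, true].
  have /andP[ld du] := d_bound i0.
  apply: l2norm_le; first by rewrite mulr_ge0 ?l2norm_ge0 //; lra.
  rewrite exprMn sqr_l2norm !dotP mulr_sumr; apply: ler_sum => i _; rewrite SU SV.
  have /andP[ldi dui] := d_bound i.
  have d2 : d 0 i * d 0 i <= u ^+ 2 by rewrite expr2 ler_pM //; lra.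
  have p1 := sqr_ge0 ((U *m x) i 0); have p2 := sqr_ge0 ((V *m x) i 0).
  nra.
have -> : x = 0 by apply/colP => i; case/existsP: m0; exists i.
by rewrite mulmx0 !l2norm0 mulr0.
Qed.
End SymmetricMatrix.

(** * Contraction of zero-average vectors by the mixing matrix *)

Section Contraction.
Variable R : realType.

(** Turns the sorted-list definition into its usable form: counted with multiplicity, at most one
    eigenvalue exceeds [sigma] in magnitude. *)
Lemma second_largest_magnitude_le (m : nat) (W : 'M[R]_m) (sigma : R)
    (d : 'rV[R]_m) :
  second_largest_eigenvalue_magnitude W sigma ->
  char_poly W = \prod_i ('X - (d 0 i)%:P) ->
  forall i j, sigma < `|d 0 i| -> sigma < `|d 0 j| -> i = j.
Proof.
move=> [s [Ws ->]] Wd.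
set ms : seq R := sort _ _; set b : R := nth 0 ms 1.
have ms_sorted : sorted >=%R ms by apply: sort_sorted => x y; exact: le_total.
have ms_count : (count (fun a : R => b < a)%R ms <= 1)%N.
  rewrite /b {b}; case: ms ms_sorted => [|a [|c ms]] //=; first by rewrite addn0 leq_b1.
  move=> /andP[_ c_ms]; rewrite ltxx add0n.
  have /allP c_max : all (fun x => x <= c) ms.
    by apply: (order_path_min _ c_ms) => x y z xy /le_trans; exact.
  rewrite (@eq_in_count _ _ pred0) ?count_pred0 ?addn0 ?leq_b1 //.
  by move=> x /c_max; rewrite leNgt => /negbTE.
(* Two factorizations into monic linear factors have the same roots up to order. *)
have ds : perm_eq [seq d 0 i | i <- enum 'I_m] s.
  by apply: prod_XsubC_eq; rewrite big_map big_enum -Wd Ws.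
have d_count : (#|[pred i | (b < `|d 0 i|)%R]| <= 1)%N.
  apply: leq_trans ms_count; rewrite (permP (permEl (perm_sort _ _))) count_map.
  by rewrite -(permP ds) count_map -sum1_count -sum1_card big_enum_cond.
by move=> i j bi bj; apply: (card_le1_eqP d_count); rewrite inE.
Qed.

(** The all-ones vector is fixed by [W], so its spectral components sit at eigenvalue 1, beyond
    [sigma]; hence it has exactly one nonzero component, at [i0]. Orthogonality to it kills the [i0]
    component of [y], and every other eigenvalue is at most [sigma] in magnitude. *)
Lemma mixing_contraction (m : nat) (W : 'M[R]_m) (sigma : R) (y : 'cV[R]_m) :
  W^T = W -> W *m const_mx 1 = const_mx 1 :> 'cV_m ->
  second_largest_eigenvalue_magnitude W sigma -> 0 <= sigma -> sigma < 1 ->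
  dot (const_mx 1) y = 0 ->
  dot (W *m y) (W *m y) <= sigma ^+ 2 * dot y y.
Proof.
move=> W_sym W1 W_sigma sigma_ge0 sigma_lt1 y1.
set one : 'cV[R]_m := const_mx 1.
have [U [V [d [/dot_parseval dotP UVC US VS Wchar]]]] := symmetric_spectral W_sym.
have one_big := second_largest_magnitude_le W_sigma Wchar.
(* Since [U^T V] is symmetric, the imaginary part of the Hermitian product of two real vectors is
   zero. *)
have cross (x z : 'cV[R]_m) :
    0 = \sum_i ((U *m x) i 0 * (V *m z) i 0 - (V *m x) i 0 * (U *m z) i 0).
  by rewrite sumrB -!dotE !dot_mulmx UVC subrr.
have SU (x : 'cV[R]_m) i : (U *m (W *m x)) i 0 = d 0 i * (U *m x) i 0.
  by rewrite mulmxA US -mulmxA mul_diag_mx mxE.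
have SV (x : 'cV[R]_m) i : (V *m (W *m x)) i 0 = d 0 i * (V *m x) i 0.
  by rewrite mulmxA VS -mulmxA mul_diag_mx mxE.
(* Squared modulus of the [i]-th complex coordinate of the all-ones vector. *)
pose e i := (U *m one) i 0 ^+ 2 + (V *m one) i 0 ^+ 2.
have e0 i : e i = 0 -> (U *m one) i 0 = 0 /\ (V *m one) i 0 = 0.
  by rewrite /e => ei; split; nra.
have d1 i : e i != 0 -> d 0 i = 1.
  move=> ei; have := SU one i; have := SV one i; rewrite W1 -/one => h1 h2.
  apply/eqP; rewrite -subr_eq0; move: ei; apply: contraNT => /eqP di.
  have hu : (U *m one) i 0 = 0 by apply: (mulfI (introN eqP di)); lra.
  have hv : (V *m one) i 0 = 0 by apply: (mulfI (introN eqP di)); lra.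
  by rewrite /e hu hv expr0n addr0.
(* If all components vanish then the all-ones vector is zero, which forces [m = 0] and makes both
   sides 0. *)
have [/existsP[i0 ei0]|no_e] := boolP [exists i, e i != 0]; last first.
  have e_all i : e i = 0.
    by apply/eqP; move: no_e; rewrite negb_exists => /forallP/(_ i)/negPn.
  have one0 : dot one one = 0.
    rewrite dotP big1 // => i _; have [-> ->] := e0 i (e_all i); ring.
  case: (posnP m) => [m0|m_gt0].
    by rewrite !dotE !big1 ?mulr0 // => i; exfalso; move: (ltn_ord i); rewrite {2}m0.
  move/eqP: one0; rewrite dotvv_eq0 => /eqP/colP/(_ (Ordinal m_gt0)).
  by rewrite !mxE => /eqP; rewrite oner_eq0.
have d_le i : i != i0 -> `|d 0 i| <= sigma.
  move=> ii0; rewrite leNgt; apply: contra ii0 => hi; apply/eqP.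
  by apply: one_big => //; rewrite (d1 _ ei0) normr1.
have e_i i : i != i0 -> e i = 0.
  move=> ii0; apply/eqP; apply: contraTT (d_le i ii0) => /d1 ->.
  by rewrite normr1 -ltNge.
have y_i0 : (U *m y) i0 0 = 0 /\ (V *m y) i0 0 = 0.
  have := y1; have := cross one y; rewrite dotP (bigD1 i0) //= big1 ?addr0; last first.
    by move=> i /e_i/e0[-> ->]; ring.
  rewrite [X in X = 0 -> _](bigD1 i0) //= big1 ?addr0; last first.
    by move=> i /e_i/e0[-> ->]; ring.
  move: ei0; rewrite /e; move: ((U *m one) i0 0) ((V *m one) i0 0) ((U *m y) i0 0) ((V *m y) i0 0).
  move=> a b a' b'.
  (* The hypotheses say that the conjugate of [a + i b] times [a' + i b'] is 0; multiplying back by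
     [a + i b] isolates [a'] and [b'] with factor [a^2 + b^2], which is nonzero. *)
  move=> ab h1 h2; split; apply: (mulfI ab); rewrite mulr0.
    by transitivity (a * (a * a' + b * b') - b * (a * b' - b * a')); [ring|rewrite h2 -h1; ring].
  by transitivity (b * (a * a' + b * b') + a * (a * b' - b * a')); [ring|rewrite h2 -h1; ring].
rewrite !dotP mulr_sumr; apply: ler_sum => i _; rewrite !SU !SV.
have [->|ii0] := eqVneq i i0.
  by have [-> ->] := y_i0; rewrite !mulr0 addr0 mulr0.
have d2 : d 0 i ^+ 2 <= sigma ^+ 2.
  by rewrite -[d 0 i ^+ 2]real_normK ?num_real // lerXn2r ?nnegrE ?d_le.
by have p1 := sqr_ge0 ((U *m y) i 0); have p2 := sqr_ge0 ((V *m y) i 0); nra.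
Qed.

End Contraction.

(** * Modified BFGS matrices *)

Lemma psi_gt0 (R : realType) (q : adadqn_params R) (L : R) :
  0 < L -> 0 < q_lbound_eig q -> 0 < q_varrho q -> 0 < psi q L.
Proof.
move=> L_gt0 l_gt0 rho_gt0.
rewrite /psi !lt_min ltr01 l_gt0 divr_gt0 // mulr_gt0 // exprn_gt0 //.
by rewrite addr_gt0 // mulr_gt0.
Qed.

Lemma psi_le1 (R : realType) (q : adadqn_params R) (L : R) : psi q L <= 1.
Proof. by rewrite /psi ge_min lexx. Qed.

Lemma Psi_ge1 (R : realType) (q : adadqn_params R) : 1 <= Psi q.
Proof. by rewrite /Psi le_max lexx. Qed.

Section BFGS.
Variables (R : realType) (p : nat).
Implicit Types (s y z x : 'cV[R]_p).

Lemma bfgs_mx_sym s y : (bfgs_mx s y)^T = bfgs_mx s y.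
Proof.
apply/matrixP => i j; rewrite !mxE !big_ord1 !mxE (eq_sym j); ring.
Qed.

Lemma outer_mulmx x y z : x *m y^T *m z = dot y z *: x.
Proof. by rewrite -mulmxA [y^T *m z]mx11_scalar mul_mx_scalar. Qed.

Lemma bfgs_mulmx s y z : bfgs_mx s y *m z =
  (dot s y / dot y y) *: z - (dot y y)^-1 *: (dot y z *: s + dot s z *: y)
  + (2 / dot s y * dot s z) *: s.
Proof.
rewrite /bfgs_mx sqr_l2norm !mulmxDl mulNmx mul_scalar_mx -!scalemxAl mulmxDl.
by rewrite !outer_mulmx scalerA.
Qed.

(* On span(s, y) the matrix has trace [2 b] and determinant [a0 b], where
   [a0 = s.y/|y|^2] and [b = |s|^2/s.y]; it is [a0] on the orthogonal
   complement. *)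
Lemma bfgs_eigenvalue s y a : 0 < dot s y -> eigenvalue (bfgs_mx s y) a ->
  dot s y / (2 * dot y y) <= a <= 2 * dot s s / dot s y.
Proof.
move=> sy_gt0 /eigenvalueP[v va v0].
have y_gt0 : 0 < dot y y.
  by rewrite dotvv_gt0; apply: contraTneq sy_gt0 => ->; rewrite dotC dot0l ltxx.
have cs := cauchy_schwarz s y.
pose w := v^T; have w0 : 0 < dot w w.
  by rewrite dotvv_gt0; apply: contra v0 => /eqP/(congr1 trmx); rewrite trmxK trmx0 => ->.
have wa z : dot w (bfgs_mx s y *m z) = a * dot w z.
  by rewrite /dot trmxK mulmxA va -scalemxAl mxE.
(* Testing the eigenvector equation against [y], [s] and [w] leaves scalar equations in [P = w.y]
   and [Q = w.s]. *)
have := wa w; have := wa s; have := wa y.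
rewrite !bfgs_mulmx !(dotDr, dotNr, dotZr) (dotC s w) (dotC y w) (dotC y s).
move: (dot w w) w0 (dot w y) (dot w s) (dot s y) (dot y y) (dot s s)
  sy_gt0 y_gt0 cs => ww ww_gt0 P Q sy yy ss sy_gt0 yy_gt0 cs.
have sy0 : sy != 0 by rewrite gt_eqF.
have yy0 : yy != 0 by rewrite gt_eqF.
set a0 := sy / yy; set b := ss / sy.
have a0_gt0 : 0 < a0 by rewrite divr_gt0.
have a0b : a0 <= b.
  by rewrite /a0 /b ler_pdivlMr // mulrAC ler_pdivrMr // -expr2.
have -> : sy / (2 * yy) = a0 / 2 by rewrite /a0; field; rewrite ?sy0 ?yy0.
have -> : 2 * ss / sy = 2 * b by rewrite /b; field; rewrite ?sy0 ?yy0.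
have -> : a0 * P - yy^-1 * (yy * Q + sy * P) + 2 / sy * sy * Q = Q.
  by rewrite /a0; field; rewrite ?sy0 ?yy0.
have -> : a0 * Q - yy^-1 * (sy * Q + ss * P) + 2 / sy * ss * Q = 2 * b * Q - a0 * b * P.
  by rewrite /a0 /b; field; rewrite ?sy0 ?yy0.
move=> hy hs hw.
(* If [P = 0] then [w] is orthogonal to both [s] and [y], and [a = a0]. Otherwise [a] is a root of
   [a^2 - 2 b a + a0 b], and [a (2 b - a) = a0 b > 0] confines it. *)
have [P0|P_neq0] := eqVneq P 0.
  have Q0 : Q = 0 by rewrite hy P0 mulr0.
  have -> : a = a0.
    by apply: (mulIf (lt0r_neq0 ww_gt0)); rewrite -hw P0 Q0 !mul0r !mulr0; ring.
  by apply/andP; split; lra.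
have ha : 2 * b * a - a0 * b = a ^+ 2.
  rewrite hy in hs; apply: (mulIf P_neq0); by transitivity (a * (a * P)); [rewrite -hs|]; ring.
have a_gt0 : 0 < a by nra.
by apply/andP; split; nra.
Qed.

Lemma eigenvalue1 a : eigenvalue (1%:M : 'M[R]_p) a -> a = 1.
Proof.
move=> /eigenvalueP[v]; rewrite mulmx1 -{1}(scale1r v) => /eqP.
by rewrite -subr_eq0 -scalerBl scaler_eq0 subr_eq0 => /orP[/eqP<-//|->].
Qed.

(** The identity and the accepted matrix are bounded by 1 and by the eigenvalue test. In the
    fallback, the shift by [h s] ensures [s.y >= varrho |s|^2] and [|y| <= (2 L + varrho) |s|], so
    [bfgs_eigenvalue] yields the remaining terms of [psi] and [Psi]. *)
Lemma mbfgs_bounds (q : adadqn_params R) (L : R) s yc dg :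
  0 < L -> 0 < q_lbound_eig q -> 0 < q_varrho q ->
  l2norm dg <= L * l2norm s -> forall x,
  psi q L * dot x x <= dot x (mbfgs q s yc dg *m x) /\
  l2norm (mbfgs q s yc dg *m x) <= Psi q * l2norm x.
Proof.
move=> L_gt0 l_gt0 rho_gt0 dg_le x.
set lo := psi q L; set hi := Psi q; set H := mbfgs q s yc dg.
have lo_gt0 : 0 < lo by exact: psi_gt0.
suff [H_sym H_eig] : H^T = H /\ forall a, eigenvalue H a -> lo <= a <= hi.
  have [h1 h2] := symmetric_quadratic_form H_sym H_eig x.
  by split=> //; exact: h2 (ltW lo_gt0).
have lo1 : lo <= 1 by exact: psi_le1.
have hi1 : 1 <= hi by exact: Psi_ge1.
rewrite /H /mbfgs; case: eqVneq => [_|s0].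
  split=> [|a /eigenvalue1 ->]; last by rewrite lo1 hi1.
  exact: trmx1.
case: ifP => [/andP[_ /asboolP eig_ok]|_].
  split=> [|a /eig_ok/andP[la au]]; first exact: bfgs_mx_sym.
  rewrite /lo /hi /psi /Psi.
  by rewrite !ge_min la orbT !le_max au !orbT.
split=> [|a]; first exact: bfgs_mx_sym.
set h := q_varrho q + _; set y := dg + _ => a_eig.
have ss_gt0 : 0 < dot s s by rewrite dotvv_gt0.
have s_gt0 : 0 < l2norm s by rewrite l2norm_gt0.
have m_ge : - dot s dg / dot s s <= Num.max (- dot s dg / l2norm s ^+ 2) 0.
  by rewrite sqr_l2norm le_max lexx.
have sy_ge : q_varrho q * dot s s <= dot s y.
  rewrite /y dotDr dotZr /h mulrDl.
  have : - dot s dg / dot s s * dot s s <= Num.max (- dot s dg / l2norm s ^+ 2) 0 * dot s s.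
    by rewrite ler_wpM2r // ltW.
  rewrite divfK ?gt_eqF //; lra.
have h_ge0 : 0 <= h by rewrite addr_ge0 ?(ltW rho_gt0) // le_max lexx orbT.
(* By Cauchy-Schwarz and [|dg| <= L |s|], the curvature correction is at most [L]. *)
have h_le : h <= q_varrho q + L.
  rewrite lerD2l ge_max (ltW L_gt0) andbT ler_pdivrMr ?exprn_gt0 //.
  have := normr_dot_le s dg; rewrite ler_norml => /andP[+ _].
  have := l2norm_ge0 s; nra.
have y_le : l2norm y <= (2 * L + q_varrho q) * l2norm s.
  have := l2normD dg (h *: s); rewrite -/y l2normZ ger0_norm //; nra.
have sy_gt0 : 0 < dot s y by apply: lt_le_trans sy_ge; rewrite mulr_gt0.
have yy_gt0 : 0 < dot y y.
  by rewrite dotvv_gt0; apply: contraTneq sy_gt0 => ->; rewrite dotC dot0l ltxx.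
have yy_le : dot y y <= (2 * L + q_varrho q) ^+ 2 * dot s s.
  by rewrite -!sqr_l2norm -exprMn lerXn2r ?nnegrE ?l2norm_ge0 // mulr_ge0 ?l2norm_ge0 //; lra.
have /andP[lo_a a_hi] := bfgs_eigenvalue sy_gt0 a_eig.
have D_gt0 : 0 < 2 * L + q_varrho q by lra.
apply/andP; split.
  apply: le_trans lo_a; rewrite /lo /psi !ge_min; apply/orP; right; apply/orP; right.
  rewrite ler_pdivrMr ?mulr_gt0 ?exprn_gt0 // mulrAC ler_pdivlMr ?mulr_gt0 //.
  nra.
apply: le_trans a_hi _; rewrite /hi /Psi !le_max; apply/orP; right; apply/orP; right.
rewrite ler_pdivrMr // mulrAC ler_pdivlMr //; nra.
Qed.

End BFGS.

(** * Functions with Lipschitz gradient *)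

Section LipschitzGradient.
Variable R : realType.

Lemma taylor1_le (phi dphi : R -> R) (c : R) :
  (forall t, is_derive (t : R) (1 : R) phi (dphi t)) ->
  (forall t, 0 <= t -> dphi t - dphi 0 <= c * t) ->
  phi 1 - phi 0 - dphi 0 <= c / 2.
Proof.
move=> phi' dphi_le.
pose g := phi - (dphi 0 \*: id + (c / 2) \*: (id ^+ 2 : R -> R)) : R -> R.
have g' t : is_derive (t : R) (1 : R) g (dphi t - (dphi 0 * 1 + (c / 2) * (2 * t))).
  apply: is_deriveB; apply: is_deriveD; apply: is_deriveZ.
  by apply: is_derive_eq; rewrite /GRing.scale /= expr1 mulr1 mulr_natl.
have g_cont : {within `[0, 1], continuous g}.
  by apply: derivable_within_continuous => t _; apply: ex_derive.
have [t /andP[t0 _] gt] := MVT ltr01 (fun t _ => g' t) g_cont.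
have gE s : g s = phi s - (dphi 0 * s + c / 2 * s ^+ 2) by [].
have := dphi_le t (ltW t0); move: gt; rewrite !gE expr1n expr0n /=; lra.
Qed.

Section Gradient.
Variables (p : nat) (f : 'cV[R]_p -> R).
Hypothesis f_diff : forall z, differentiable f z.

Lemma derive_gradient z v : 'D_v f z = dot (gradient f z) v.
Proof.
rewrite deriveE // {1}(matrix_sum_delta v) exchange_big big_ord1 /=.
rewrite linear_sum dotE; apply: eq_bigr => j _.
by rewrite linearZ /= mxE deriveE // mulrC.
Qed.

Lemma is_derive_line x v t :
  is_derive (t : R) (1 : R) (fun s => f (x + s *: v)) (dot (gradient f (x + t *: v)) v).
Proof.
have lineE : (fun h : R => h^-1 *: (((fun s => f (x + s *: v)) \o shift t) (h *: 1)
       - f (x + t *: v)))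
    = (fun h : R => h^-1 *: ((f \o shift (x + t *: v)) (h *: v) - f (x + t *: v))).
  by apply/funext => h /=; rewrite [_%:A]mulr1 scalerDl addrCA.
split.
  by rewrite /derivable lineE; exact: diff_derivable.
by rewrite /derive lineE -derive_gradient.
Qed.

Variable L : R.
Hypothesis f_lip : forall z w,
  l2norm (gradient f z - gradient f w) <= L * l2norm (z - w).

(** Without convexity both signs matter: the upper bound gives descent, the lower bound later
    converts a decrease of [f] into a bound on an inner product. They come from [taylor1_le] applied
    along the segment to [phi] and [- phi]. *)
Lemma lipschitz_gradient_bound x y :
  `|f y - f x - dot (gradient f x) (y - x)| <= L / 2 * dot (y - x) (y - x).
Proof.
set v := y - x; have yE : y = x + 1 *: v by rewrite scale1r addrC subrK.
pose phi t := f (x + t *: v); pose dphi t := dot (gradient f (x + t *: v)) v.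
have phi' t : is_derive (t : R) (1 : R) phi (dphi t) by exact: is_derive_line.
have dphi_le t : 0 <= t -> `|dphi t - dphi 0| <= L * dot v v * t.
  move=> t0; rewrite /dphi -dotBl; apply: le_trans (normr_dot_le _ _) _.
  rewrite -sqr_l2norm expr2 mulrA mulrAC ler_wpM2r ?l2norm_ge0 //.
  apply: le_trans (f_lip _ _) _.
  by rewrite scale0r addr0 addrAC subrr add0r l2normZ ger0_norm // -mulrA (mulrC t).
have phi0 : phi 0 = f x by rewrite /phi scale0r addr0.
have phi1 : phi 1 = f y by rewrite /phi -yE.
have dphi0 : dphi 0 = dot (gradient f x) v by rewrite /dphi scale0r addr0.
rewrite -phi0 -phi1 -dphi0 mulrAC ler_norml; apply/andP; split.
  have : - phi 1 - - phi 0 - - dphi 0 <= L * dot v v / 2; last by lra.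
  apply: (@taylor1_le (- phi) (- dphi)) => t /dphi_le.
  rewrite ler_norml => /andP[lo hi].
  by change (- dphi t - - dphi 0 <= L * dot v v * t); lra.
by apply: taylor1_le => // t /dphi_le; exact/le_trans/ler_norm.
Qed.

End Gradient.
End LipschitzGradient.

(** * Event-triggered communication *)

Section Stack.
Variables (R : realType) (n p : nat).
Implicit Types u w : 'I_n -> 'cV[R]_p.

Definition deviation u : 'I_n -> 'cV[R]_p := fun i => u i - average u.

(** Block form of the Kronecker product of [W] and the identity, applied to the stacked vector. *)
Definition mix (W : 'M[R]_n) u : 'I_n -> 'cV[R]_p :=
  fun i => \sum_j W i j *: u j.

Lemma sum_stack (F : 'I_n -> 'I_p -> R) :
  \sum_(k < n * p) F (mxtens_unindex k).1 (mxtens_unindex k).2 =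
  \sum_i \sum_j F i j.
Proof.
rewrite pair_bigA /= (reindex (@mxtens_index n p)); last first.
  by exists (@mxtens_unindex n p) => k _; rewrite ?mxtens_indexK ?mxtens_unindexK.
by apply: eq_bigr => ij _; have /(congr1 (fun x => F x.1 x.2)) := mxtens_indexK ij.
Qed.

Lemma dot_stack u w : dot (stack u) (stack w) = \sum_i dot (u i) (w i).
Proof.
rewrite dotE; under eq_bigr do rewrite !mxE.
rewrite (sum_stack (fun i j => u i j 0 * w i j 0)).
by apply: eq_bigr => i _; rewrite dotE.
Qed.

Lemma sqr_l2norm_stack u : l2norm (stack u) ^+ 2 = \sum_i l2norm (u i) ^+ 2.
Proof. by rewrite sqr_l2norm dot_stack; apply: eq_bigr => i _; rewrite sqr_l2norm. Qed.

Lemma stackD u w : stack (fun i => u i + w i) = stack u + stack w.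
Proof. by apply/colP => k; rewrite !mxE. Qed.

Lemma stackB u w : stack (fun i => u i - w i) = stack u - stack w.
Proof. by apply/colP => k; rewrite !mxE. Qed.

Lemma averaging_mx_stack u :
  averaging_mx R n p *m stack u = stack (fun=> average u).
Proof.
apply/colP => k; rewrite /average !mxE summxE.
under eq_bigr do rewrite !mxE big_ord1 !mxE mul1r mulr1.
rewrite (sum_stack (fun i j => n%:R^-1 * ((mxtens_unindex k).2 == j)%:R * u i j 0)).
rewrite mulr_sumr; apply: eq_bigr => i _.
rewrite (bigD1 (mxtens_unindex k).2) //= eqxx mulr1 big1 ?addr0 // => j.
by rewrite eq_sym => /negbTE ->; rewrite mulr0 mul0r.
Qed.

Lemma stack_deviation u :
  stack u - averaging_mx R n p *m stack u = stack (deviation u).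
Proof. by rewrite averaging_mx_stack -stackB. Qed.

Lemma eq_stack u w : u =1 w -> stack u = stack w.
Proof. by move=> uw; apply/colP => k; rewrite !mxE uw. Qed.

Lemma averageD u w : average (fun i => u i + w i) = average u + average w.
Proof. by rewrite /average big_split scalerDr. Qed.

Lemma averageB u w : average (fun i => u i - w i) = average u - average w.
Proof. by rewrite /average sumrB scalerBr. Qed.

Lemma deviationD u w :
  deviation (fun i => u i + w i) =1 (fun i => deviation u i + deviation w i).
Proof. by move=> i; rewrite /deviation averageD opprD addrACA. Qed.

Lemma deviationB u w :
  deviation (fun i => u i - w i) =1 (fun i => deviation u i - deviation w i).
Proof. by move=> i; rewrite /deviation averageB opprD addrACA -opprD. Qed.

Hypothesis n_gt0 : (0 < n)%N.
Let n_neq0 : n%:R != 0 :> R.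
Proof. by rewrite pnatr_eq0 -lt0n. Qed.

Lemma average_cst (c : 'cV[R]_p) : average (fun _ : 'I_n => c) = c.
Proof. by rewrite /average sumr_const card_ord -[c *+ n]scaler_nat scalerA mulVf ?scale1r. Qed.

Lemma average_deviation u : average (deviation u) = 0.
Proof. by rewrite averageB average_cst subrr. Qed.

Lemma sum_average u : \sum_i u i = n%:R *: average u.
Proof. by rewrite /average scalerA mulfV // scale1r. Qed.

(** Pythagoras: the cross term vanishes because the deviations sum to zero. *)
Lemma sqr_l2norm_stack_average u :
  l2norm (stack u) ^+ 2 =
  n%:R * dot (average u) (average u) + l2norm (stack (deviation u)) ^+ 2.
Proof.
rewrite !sqr_l2norm_stack; set a := average u.
have -> : \sum_i l2norm (u i) ^+ 2 =
    \sum_i (dot a a + 2 * dot a (deviation u i) + l2norm (deviation u i) ^+ 2).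
  apply: eq_bigr => i _; rewrite !sqr_l2norm /deviation -/a.
  by rewrite !(dotBl, dotBr) (dotC (u i) a); ring.
have cross : \sum_i 2 * dot a (deviation u i) = 0.
  rewrite -mulr_sumr -dot_sumr (sum_average (deviation u)) average_deviation.
  by rewrite scaler0 dotC dot0l mulr0.
by rewrite !big_split /= cross addr0 sumr_const card_ord mulr_natl.
Qed.

Lemma l2norm_deviation_le u : l2norm (stack (deviation u)) <= l2norm (stack u).
Proof.
rewrite -(@ler_pXn2r _ 2) ?nnegrE ?l2norm_ge0 // (sqr_l2norm_stack_average u).
by rewrite lerDr mulr_ge0 // dotvv_ge0.
Qed.

Lemma average_sqr_le u :
  n%:R * dot (average u) (average u) <= l2norm (stack u) ^+ 2.
Proof. by rewrite (sqr_l2norm_stack_average u) lerDl sqr_ge0. Qed.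

(** * Mixing by a symmetric doubly stochastic matrix *)

Section Mixing.
Variables (W : 'M[R]_n) (sigma : R).
Hypotheses (W_sym : W^T = W) (W_dstoch : doubly_stochastic W)
  (W_sigma : second_largest_eigenvalue_magnitude W sigma)
  (sigma_ge0 : 0 <= sigma) (sigma_lt1 : sigma < 1).

Lemma average_mix u : average (mix W u) = average u.
Proof.
rewrite /average /mix exchange_big /=; congr (_ *: _); apply: eq_bigr => j _.
by rewrite -scaler_suml; have [_ _ ->] := W_dstoch; rewrite scale1r.
Qed.

Lemma mix_cst c : mix W (fun=> c) =1 (fun=> c).
Proof.
by move=> i; rewrite /mix -scaler_suml; have [_ -> _] := W_dstoch; rewrite scale1r.
Qed.

Lemma mixB u w : mix W (fun i => u i - w i) =1 (fun i => mix W u i - mix W w i).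
Proof. by move=> i; rewrite /mix -sumrB; apply: eq_bigr => j _; rewrite scalerBr. Qed.

Lemma mix_deviation u : deviation (mix W u) =1 mix W (deviation u).
Proof. by move=> i; rewrite mixB mix_cst /deviation average_mix. Qed.

(** [W] acts separately on each of the [p] coordinates, so [mixing_contraction] applies to each
    [col k], which is orthogonal to the all-ones vector. *)
Lemma mix_contraction u : average u = 0 ->
  l2norm (stack (mix W u)) <= sigma * l2norm (stack u).
Proof.
move=> u0; rewrite -(@ler_pXn2r _ 2) ?nnegrE ?mulr_ge0 ?l2norm_ge0 //.
rewrite exprMn !sqr_l2norm !dot_stack.
pose col k : 'cV[R]_n := \col_i u i k 0.
have -> : \sum_i dot (u i) (u i) = \sum_k dot (col k) (col k).
  under eq_bigr do rewrite dotE.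
  rewrite exchange_big; apply: eq_bigr => k _; rewrite dotE.
  by apply: eq_bigr => i _; rewrite mxE.
have -> : \sum_i dot (mix W u i) (mix W u i) = \sum_k dot (W *m col k) (W *m col k).
  under eq_bigr do rewrite dotE.
  rewrite exchange_big; apply: eq_bigr => k _; rewrite dotE.
  apply: eq_bigr => i _; rewrite /mix summxE mxE.
  by congr (_ * _); apply: eq_bigr => j _; rewrite !mxE.
rewrite mulr_sumr; apply: ler_sum => k _; apply: mixing_contraction => //.
  apply/colP => i; rewrite !mxE; have [_ W1 _] := W_dstoch; rewrite -[RHS](W1 i).
  by apply: eq_bigr => j _; rewrite mxE mulr1.
have := sum_average u; rewrite u0 scaler0 => /colP/(_ k).
rewrite summxE mxE => u0k; rewrite dotE -[RHS]u0k.
by apply: eq_bigr => i _; rewrite !mxE mul1r.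
Qed.

(** Covers vectors of nonzero average, such as the communication error: the mean is preserved and
    only the deviation contracts. *)
Lemma mix_le u : l2norm (stack (mix W u)) <= l2norm (stack u).
Proof.
rewrite -(@ler_pXn2r _ 2) ?nnegrE ?l2norm_ge0 //.
rewrite (sqr_l2norm_stack_average u) (sqr_l2norm_stack_average (mix W u)).
rewrite average_mix lerD2l (eq_stack (mix_deviation u)).
rewrite lerXn2r ?nnegrE ?l2norm_ge0 //.
apply: le_trans (mix_contraction (average_deviation u)) _.
by rewrite ler_piMl ?l2norm_ge0 // ltW.
Qed.

Section EventTriggered.
Variables (e : rel 'I_n) (eta_t : R) (tau : nat -> R).
Hypotheses (W_eq0 : forall i j, j \notin neighbors e i -> W i j = 0)
  (eta_ge0 : 0 <= eta_t) (tau_ge0 : forall s, 0 <= tau s).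

Lemma sum_neighbors u i : \sum_(j in neighbors e i) W i j *: u j = mix W u i.
Proof.
rewrite /mix [RHS](bigID (mem (neighbors e i))) /= [X in _ = _ + X]big1 ?addr0 //.
by move=> j /W_eq0 ->; rewrite scale0r.
Qed.

(** A transmitting node has zero error; a silent one is below the threshold by the trigger test. At
    [s = 0] the copies are exact. *)
Lemma etc_rounds_error u s i :
  let: (us, uhat) := etc_rounds e W eta_t tau u s in
  l2norm (us i - uhat i) <= eta_t * tau s.
Proof.
case: s => [|s] /=; first by rewrite subrr l2norm0 mulr_ge0.
case: (etc_rounds _ _ _ _ _ _) => us uhat /=; case: ifPn => [_|]; last by rewrite -ltNge => /ltW.
by rewrite subrr l2norm0 mulr_ge0.
Qed.

(** With [d = u^s - uhat^s], a round is exact mixing of [u^s] plus [d - W d]. This perturbation has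
    zero average and norm at most [2 |d|], so averages are kept and deviations obey a linear
    recursion with factor [sigma]. *)
Lemma etc_rounds_deviation u s :
  let us := (etc_rounds e W eta_t tau u s).1 in
  average us = average u /\
  l2norm (stack (deviation us)) <= sigma ^+ s * l2norm (stack (deviation u))
    + 2 * (Num.sqrt n%:R * eta_t) *
      \sum_(0 <= k < s) sigma ^+ k * tau (s - 1 - k)%N.
Proof.
elim: s => [|s] /=; first by rewrite big_geq // mulr0 addr0 mul1r.
have := etc_rounds_error u s.
case: (etc_rounds _ _ _ _ _ s) => us uhat /= us_err [us_avg us_dev].
pose d i := us i - uhat i.
have stepE : (fun i => us i - (uhat i - \sum_(j in neighbors e i) W i j *: uhat j)) =1
    (fun i => mix W us i + (d i - mix W d i)).
  move=> i; rewrite sum_neighbors mixB /d.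
  by rewrite -[LHS]addr0 -(subrr (mix W us i)) !opprB; apply/colP => k; rewrite !mxE; ring.
have -> := functional_extensionality_dep stepE.
have d_avg : average (fun i => d i - mix W d i) = 0.
  by rewrite averageB average_mix subrr.
split; first by rewrite averageD average_mix d_avg addr0.
have -> : stack (deviation (fun i => mix W us i + (d i - mix W d i))) =
    stack (mix W (deviation us)) + (stack d - stack (mix W d)).
  rewrite -stackB -stackD; apply: eq_stack => i; rewrite deviationD mix_deviation.
  by rewrite {2}/deviation d_avg subr0.
(* Stacking [n] blocks, each at most [eta_t * tau s], produces the factor [sqrt n]. *)
have d_le : l2norm (stack d) <= Num.sqrt n%:R * (eta_t * tau s).
  rewrite -(@ler_pXn2r _ 2) ?nnegrE ?l2norm_ge0 ?mulr_ge0 ?sqrtr_ge0 //.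
  rewrite exprMn sqr_l2norm_stack sqr_sqrtr // mulr_natl -[X in _ *+ X]card_ord -sumr_const.
  by apply: ler_sum => i _; rewrite lerXn2r ?nnegrE ?l2norm_ge0 ?mulr_ge0 //; apply: us_err.
(* The newest error enters as the [k = 0] term [tau s]; the remaining terms are [sigma] times the
   previous sum. *)
rewrite big_nat_recl // expr0 mul1r subn0 subSS subn0.
have -> : \sum_(0 <= k < s) sigma ^+ k.+1 * tau (s - k.+1)%N =
    sigma * \sum_(0 <= k < s) sigma ^+ k * tau (s - 1 - k)%N.
  by rewrite mulr_sumr; apply: eq_bigr => k _; rewrite exprS mulrA -subnDA add1n.
apply: le_trans (l2normD _ _) _; have := l2normB (stack d) (stack (mix W d)).
have := mix_le d; have := mix_contraction (average_deviation us).
have : sigma * l2norm (stack (deviation us)) <= sigma * _ := ler_wpM2l sigma_ge0 us_dev.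
rewrite exprS; move: (\sum_(0 <= k < s) _) => S; lra.
Qed.

End EventTriggered.
End Mixing.
End Stack.

(** * Local steps of a node *)

Section LocalSteps.
Variables (R : realType) (p : nat) (q : adadqn_params R) (L : R).
Variable (f : 'cV[R]_p -> R).
Hypotheses (f_diff : forall z, differentiable f z)
  (L_gt0 : 0 < L)
  (f_lip : forall z w, l2norm (gradient f z - gradient f w) <= L * l2norm (z - w))
  (l_gt0 : 0 < q_lbound_eig q) (varrho_gt0 : 0 < q_varrho q)
  (gamma_gt0 : 0 < q_gamma q) (alpha_gt0 : 0 < q_alpha q)
  (alpha_Gamma : 2 * q_alpha q * Gamma q * L <= 1)
  (alpha_Psi : q_alpha q * L * Psi q ^+ 2 <= psi q L).

Let a := q_alpha q.
Let lo := psi q L.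
Let hi := Psi q.

(** The two consequences of the eigenvalue bounds that the descent argument consumes. *)
Definition well_conditioned (H : 'M[R]_p) :=
  forall x, lo * dot x x <= dot x (H *m x) /\ l2norm (H *m x) <= hi * l2norm x.

(* The descent lemma applied to [z |-> f z + <v, z>]. *)
Lemma quasi_newton_descent (v x : 'cV[R]_p) (H : 'M[R]_p) :
  let d := gradient f x + v in let x1 := x - a *: (H *m d) in
  well_conditioned H ->
  f x1 + dot v x1 <= f x + dot v x - a * (lo - a * L * hi ^+ 2 / 2) * dot d d.
Proof.
move=> d x1 /(_ d)[d_lo d_hi].
have := lipschitz_gradient_bound f_diff f_lip x x1.
have -> : x1 - x = - (a *: (H *m d)) by rewrite /x1 addrAC subrr add0r.
have -> : dot v x1 = dot v x - a * dot v (H *m d) by rewrite /x1 dotBr dotZr.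
have Hd : dot (H *m d) (H *m d) <= hi ^+ 2 * dot d d.
  by rewrite -!sqr_l2norm -exprMn lerXn2r ?nnegrE ?l2norm_ge0 // (le_trans (l2norm_ge0 _) d_hi).
rewrite !(dotNl, dotNr, dotZl, dotZr) ler_norml => /andP[_].
have : a * (lo * dot d d) <=
    a * (dot (gradient f x) (H *m d) + dot v (H *m d)).
  by rewrite -dotDl ler_wpM2l // ltW.
have : L / 2 * (a * a) * dot (H *m d) (H *m d) <= L / 2 * (a * a) * (hi ^+ 2 * dot d d).
  by rewrite ler_wpM2l // !mulr_ge0 // ltW.
lra.
Qed.

Section Iteration.
Variables (st0 : node_state R p).
Hypothesis st0_cond : well_conditioned (hess st0).

Let v := dir st0.
Let x0 := pos st0.
Let c := v - gradient f x0.

(** The offset [c] stays constant in the local phase, so [dir st] is the gradient of [f + <c, .>] at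
    the current point. The radius adds one step of length at most [3/2 alpha Psi |v|] to the
    distance [gamma alpha |v|] tolerated by the safeguard. *)
Definition local_invariant (st : node_state R p) :=
  [/\ dir st = gradient f (pos st) + c,
      well_conditioned (hess st),
      l2norm (pos st - x0) <= a * (q_gamma q + 3 / 2 * hi) * l2norm v
    & f (pos st) + dot c (pos st) <= f x0 + dot c x0].

Let hi_ge1 : 1 <= hi.
Proof. exact: Psi_ge1. Qed.

Let v_ge0 : 0 <= l2norm v := l2norm_ge0 v.

Let aL_gt0 : 0 < a * L.
Proof. exact: mulr_gt0. Qed.

Let aGamma : a * L * (q_gamma q + 4 * hi) <= 1 / 2.
Proof. move: alpha_Gamma; rewrite /Gamma -/a -/hi; lra. Qed.

Let aLhi : 0 <= a * L * hi.
Proof. by rewrite mulr_ge0 ?(ltW aL_gt0) //; move: hi_ge1; lra. Qed.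

Let dir_dist st : dir st = gradient f (pos st) + c ->
  l2norm (dir st - v) <= L * l2norm (pos st - x0).
Proof. by move=> ->; rewrite /c addrCA addrAC subrr add0r. Qed.

Let descent_factor : lo / 2 <= lo - a * L * hi ^+ 2 / 2.
Proof. by move: alpha_Psi; rewrite -/a -/hi -/lo; lra. Qed.

Let lo_gt0 : 0 < lo.
Proof. exact: psi_gt0. Qed.

Lemma local_invariant_init : local_invariant st0.
Proof.
split => //; first by rewrite /c addrC subrK.
by rewrite subrr l2norm0 !mulr_ge0 ?(ltW alpha_gt0) //; move: gamma_gt0 hi_ge1; lra.
Qed.

Lemma local_invariant_step (d : R) st :
  local_invariant st -> local_invariant (local_step q f d st0 st).
Proof.
move=> inv; rewrite /local_step; case: ifPn => //.
rewrite negb_or -!leNgt -/a -/v -/x0 => /andP[_ st_close].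
case: inv => dirE st_cond _ st_dec; set x1 := pos st - _.
(* The passed safeguard and [alpha L gamma <= 1/2] keep the direction within [|v| / 2] of [v]. *)
have dir_le : l2norm (dir st) <= 3 / 2 * l2norm v.
  have := dir_dist dirE; have := l2normD (dir st - v) v; rewrite subrK.
  have : L * l2norm (pos st - x0) <= L * (q_gamma q * a * l2norm v).
    by rewrite ler_wpM2l // ltW.
  have /(ler_wpM2r v_ge0) : a * L * q_gamma q <= 1 / 2 by move: aGamma aLhi; lra.
  lra.
have step_le : l2norm (a *: (hess st *m dir st)) <= a * (3 / 2 * hi) * l2norm v.
  rewrite l2normZ gtr0_norm // -mulrA ler_wpM2l ?(ltW alpha_gt0) //.
  have [_] := st_cond (dir st); have : hi * l2norm (dir st) <= hi * (3 / 2 * l2norm v).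
    by rewrite ler_wpM2l //; move: hi_ge1; lra.
  lra.
split => /=.
- by rewrite dirE addrC addrA subrK.
- move=> x; apply: mbfgs_bounds => //; exact: f_lip.
- have -> : x1 - x0 = (pos st - x0) - a *: (hess st *m dir st) by rewrite /x1 addrAC.
  apply: le_trans (l2normB _ _) _; lra.
- have := @quasi_newton_descent c (pos st) _ st_cond; rewrite /= -dirE -/x1.
  have : 0 <= a * (lo - a * L * hi ^+ 2 / 2) * dot (dir st) (dir st).
    by rewrite !mulr_ge0 ?dotvv_ge0 ?ltW //; move: descent_factor lo_gt0; lra.
  lra.
Qed.

(** This step has no safeguard, but the invariant still places the direction within [|v| / 2] of
    [v]. The total decrease of [f + <c, .>], combined with the lower Lipschitz bound on [f], then
    bounds [<v, dx>] from above. *)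
Lemma mandatory_step st :
  local_invariant st ->
  let dx := pos st - a *: (hess st *m dir st) - x0 in
  l2norm dx <= a * Gamma q * l2norm v /\
  dot v dx <= - a * (lo / 4 - a * (L * hi ^+ 2 / 8 + L * Gamma q ^+ 2 / 2)) * dot v v.
Proof.
move=> [dirE st_cond st_close st_dec] dx.
have close : l2norm (dir st - v) <= l2norm v / 2.
  apply: le_trans (dir_dist dirE) _.
  have : L * l2norm (pos st - x0) <= L * (a * (q_gamma q + 3 / 2 * hi) * l2norm v).
    by rewrite ler_wpM2l // ltW.
  have /(ler_wpM2r v_ge0) : a * L * (q_gamma q + 3 / 2 * hi) <= 1 / 2.
    by move: aGamma aLhi; lra.
  lra.
have dir_le : l2norm (dir st) <= 3 / 2 * l2norm v.
  by have := l2normD (dir st - v) v; rewrite subrK; lra.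
have dir_ge : l2norm v / 2 <= l2norm (dir st).
  by have := l2normB (dir st) (dir st - v); rewrite opprB addrC subrK; lra.
have step_le : l2norm (a *: (hess st *m dir st)) <= a * (3 / 2 * hi) * l2norm v.
  rewrite l2normZ gtr0_norm // -mulrA ler_wpM2l ?(ltW alpha_gt0) //.
  have [_] := st_cond (dir st); have : hi * l2norm (dir st) <= hi * (3 / 2 * l2norm v).
    by rewrite ler_wpM2l //; move: hi_ge1; lra.
  lra.
have dx_le : l2norm dx <= a * Gamma q * l2norm v.
  rewrite /dx addrAC; apply: le_trans (l2normB _ _) _; rewrite /Gamma -/hi.
  have : 0 <= a * hi * l2norm v by rewrite !mulr_ge0 ?(ltW alpha_gt0) //; move: hi_ge1; lra.
  lra.
split=> //.
have dx2 : dot dx dx <= (a * Gamma q) ^+ 2 * dot v v.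
  by rewrite -!sqr_l2norm -exprMn lerXn2r ?nnegrE ?l2norm_ge0 // (le_trans _ dx_le) ?l2norm_ge0.
have := @quasi_newton_descent c (pos st) _ st_cond; rewrite /= -dirE.
set x1 := pos st - _ => descent.
have x1E : x1 - x0 = dx by [].
have := lipschitz_gradient_bound f_diff f_lip x0 x1; rewrite x1E ler_norml => /andP[+ _].
have cE : dot c x1 - dot c x0 = dot v dx - dot (gradient f x0) dx.
  by rewrite -dotBr x1E /c dotBl.
(* Only the mandatory step is guaranteed to move; [|dir| >= |v| / 2] is the source of [psi / 4] and
   [L Psi^2 / 8]. *)
have dir2 : dot v v / 4 <= dot (dir st) (dir st).
  rewrite -!sqr_l2norm; have : (l2norm v / 2) ^+ 2 <= l2norm (dir st) ^+ 2.
    by rewrite lerXn2r ?nnegrE ?l2norm_ge0 ?divr_ge0.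
  lra.
have : a * (lo - a * L * hi ^+ 2 / 2) * (dot v v / 4) <=
       a * (lo - a * L * hi ^+ 2 / 2) * dot (dir st) (dir st).
  by rewrite ler_wpM2l // mulr_ge0 ?ltW //; move: descent_factor lo_gt0; lra.
have : L / 2 * dot dx dx <= L / 2 * ((a * Gamma q) ^+ 2 * dot v v).
  by rewrite ler_wpM2l // divr_ge0 // ltW.
move: descent st_dec cE; lra.
Qed.

Lemma local_invariant_iter (d : R) k : local_invariant (iter k (local_step q f d st0) st0).
Proof.
by elim: k => [|k IH] /=; [exact: local_invariant_init | exact: local_invariant_step].
Qed.

End Iteration.
End LocalSteps.

(** * Scalar inequalities *)

Section Scalar.
Variable R : realFieldType.
Implicit Types (r s L a c y z d : R).

(** Young's inequality stated from [z^2 <= A B], the form in which Cauchy-Schwarz bounds the cross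
    terms; the squared right side exceeds [A B] by a perfect square. *)
Lemma young_le (z A B c : R) : 0 < c -> 0 <= A -> 0 <= B -> z ^+ 2 <= A * B ->
  z <= c * A + B / (4 * c).
Proof.
move=> c0 A0 B0 zAB; have rhs_ge0 : 0 <= c * A + B / (4 * c).
  by rewrite addr_ge0 ?divr_ge0 ?mulr_ge0 ?(ltW c0).
apply: le_trans (ler_norm z) _; rewrite -(@ler_pXn2r _ 2) ?nnegrE //.
rewrite real_normK ?num_real //; apply: le_trans zAB _.
have -> : (c * A + B / (4 * c)) ^+ 2 = A * B + (c * A - B / (4 * c)) ^+ 2.
  by field; rewrite gt_eqF.
by rewrite lerDl sqr_ge0.
Qed.

(** The first bound keeps a contraction factor at the price of [1 / (1 - r)]. The second has
    absolute constants and serves where the new consensus error enters the tracking recursion. *)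
Lemma contraction_sqr_le (rho y y' d ep : R) : 0 <= rho -> rho < 1 ->
  0 <= y -> 0 <= d -> 0 <= ep -> 0 <= y' ->
  y' <= rho * (y + d) + 2 * ep ->
  let r := rho ^+ 2 in
  y' ^+ 2 <= (1 + r) / 2 * y ^+ 2
             + (1 + r) / (1 - r) * (2 * r * d ^+ 2 + 8 * ep ^+ 2)
  /\ y' ^+ 2 <= 18 / 5 * (y ^+ 2 + d ^+ 2) + 9 * ep ^+ 2.
Proof.
move=> rho0 rho1 y0 d0 ep0 y'0 y'_le r.
have r1 : 0 < 1 - r by rewrite subr_gt0 /r expr_lt1.
have r0 : 0 <= r by exact: sqr_ge0.
split.
  set z := rho * d + 2 * ep; have z0 : 0 <= z by rewrite addr_ge0 ?mulr_ge0.
  have y'2 : y' ^+ 2 <= (rho * y + z) ^+ 2.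
    by rewrite lerXn2r ?nnegrE ?addr_ge0 ?mulr_ge0 // /z; lra.
  have z2 : z ^+ 2 <= 2 * r * d ^+ 2 + 8 * ep ^+ 2.
    by have := sqr_ge0 (rho * d - 2 * ep); rewrite /z /r; lra.
  have f0 : 0 <= (1 + r) / (1 - r) by rewrite divr_ge0 ?(ltW r1) ?addr_ge0.
  have := ler_wpM2l f0 z2.
  have : 0 <= (((1 - r) * y - 2 * rho * z) ^+ 2) / (2 * (1 - r)).
    by rewrite divr_ge0 ?sqr_ge0 ?mulr_ge0 ?(ltW r1).
  (* The Young gap is exactly this square. *)
  have -> : (((1 - r) * y - 2 * rho * z) ^+ 2) / (2 * (1 - r)) =
      (1 + r) / 2 * y ^+ 2 + (1 + r) / (1 - r) * z ^+ 2 - (rho * y + z) ^+ 2.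
    by rewrite /r; field; rewrite -/r gt_eqF.
  lra.
have y'2 : y' ^+ 2 <= (y + d + 2 * ep) ^+ 2.
  rewrite lerXn2r ?nnegrE ?addr_ge0 ?mulr_ge0 //.
  apply: le_trans y'_le _; by rewrite lerD2r ler_piMl ?addr_ge0 ?(ltW rho1).
(* The first square splits the cross term [4 (y + d) ep] as [4/5 (y + d)^2 + 5 ep^2]; the second
   bounds [(y + d)^2] by [2 (y^2 + d^2)]. *)
have := sqr_ge0 (4 * (y + d) - 10 * ep); have := sqr_ge0 (y - d); lra.
Qed.

(** Scalar core of the argument. [D], [S] and [E] are the squared local displacement, iterate change
    and trigger error; [I0], [I1], [I2] are the descent, tracking and consensus parts of the inner
    product in the descent lemma. *)
Lemma potential_decrease (n r L a Gm lo hi F F' X X' V V' N D E S I0 I1 I2 : R) :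
  0 < n -> 0 <= r -> r < 1 -> 0 < L -> 0 < a ->
  0 <= X -> 0 <= V -> 0 <= N -> 0 <= D -> 0 <= E ->
  D <= a ^+ 2 * Gm ^+ 2 * N ->
  X' <= (1 + r) / 2 * X + (1 + r) / (1 - r) * (2 * r * D + 8 * E) ->
  X' <= 18 / 5 * (X + D) + 9 * E ->
  S <= D + 2 * X + 2 * X' ->
  V' <= (1 + r) / 2 * V + (1 + r) / (1 - r) * (2 * r * (L ^+ 2 * S) + 8 * E) ->
  F' <= F + n^-1 * (I0 + I1 + I2) + L / 2 * (n^-1 * D) ->
  I0 <= - a * (lo / 4 - a * (L * hi ^+ 2 / 8 + L * Gm ^+ 2 / 2)) * N ->
  I1 ^+ 2 <= V * D -> I2 ^+ 2 <= X * (L ^+ 2 * D) ->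
  let cv := (1 - r) ^+ 2 / (288 * (1 + r) * L ^+ 2) in
  let Cnet := L + 2 * L ^+ 2 / (n * (1 - r))
    + 288 * (1 + r) * L ^+ 2 / (n * (1 - r) ^+ 3)
    + 2 * n * r * ((1 + r) / (1 - r)) + 7 / 24 * n * r * (1 - r) in
  let Cf := a / n * (lo / 4 - a * (L * hi ^+ 2 / 8 + Gm ^+ 2 * Cnet)) in
  let Cx := (1 - r) * (3 - 2 * r) / 8 in
  let Cv := (1 - r) ^+ 3 / (1152 * (1 + r) * L ^+ 2) in
  F' + X' + cv * V' <= F + X + cv * V - (Cf * N + Cv * V + Cx * X)
    + (8 * ((1 + r) / (1 - r))
       + (1 - r) * (1 + 3 * r * L ^+ 2) / (24 * L ^+ 2)) * E.
Proof.
move=> n0 r0 r1 L0 a0 X0 V0 N0 D0 E0 DN hX hX' hS hV hF hI0 hI1 hI2.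
have [s [s0 sE]] : exists s, 0 < s /\ r = 1 - s by exists (1 - r); split; lra.
have u0 : 0 < 1 + r by lra.
have s_neq0 : s != 0 by rewrite gt_eqF.
have u_neq0 : 1 + r != 0 by rewrite gt_eqF.
have n_neq0 : n != 0 by rewrite gt_eqF.
have L_neq0 : L != 0 by rewrite gt_eqF.
have sr : 1 - r = s by lra.
rewrite !sr in hX hV *.
have [u [uE uE']] : exists u, u = 1 + r /\ 0 < u by exists (1 + r).
rewrite -!uE in hX hV u_neq0 *.
cbv zeta; set cv := s ^+ 2 / _; set Cnet := L + _ + _ + _ + _.
set Cf := a / n * _; set Cx := s * _ / 8; set Cv := s ^+ 3 / _.
have k0 : 0 < u / s by rewrite divr_gt0.
have w0 : 0 < s / L ^+ 2 by rewrite divr_gt0 ?exprn_gt0.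
have c288 : 0 < 288 :> R by rewrite ltr0n.
have c1152 : 0 < 1152 :> R by rewrite ltr0n.
have Cv0 : 0 < Cv by rewrite divr_gt0 ?mulr_gt0 ?c1152 ?exprn_gt0.
(* The weight [Cv] spends half of the tracking decrease [2 Cv V]; the other half survives in the
   conclusion. *)
have young1 : n^-1 * I1 <= Cv * V + 288 * u * L ^+ 2 / (n ^+ 2 * s ^+ 3) * D.
  have := @young_le (n^-1 * I1) V (D / n ^+ 2) Cv Cv0 V0.
  have -> : D / n ^+ 2 / (4 * Cv) = 288 * u * L ^+ 2 / (n ^+ 2 * s ^+ 3) * D.
    by rewrite /Cv; field; rewrite ?n_neq0 ?s_neq0 ?u_neq0 ?L_neq0.
  apply; first by rewrite divr_ge0 ?sqr_ge0.
  by rewrite exprMn exprVn mulrC mulrA ler_wpM2r // invr_ge0 sqr_ge0.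
(* The weight [s / 8] leaves [3/8 s X] of the consensus decrease [s / 2 X]. *)
have young2 : n^-1 * I2 <= s / 8 * X + 2 * L ^+ 2 / (n ^+ 2 * s) * D.
  have := @young_le (n^-1 * I2) X (L ^+ 2 * D / n ^+ 2) (s / 8) _ X0.
  have -> : L ^+ 2 * D / n ^+ 2 / (4 * (s / 8)) = 2 * L ^+ 2 / (n ^+ 2 * s) * D.
    by field; rewrite ?n_neq0 ?s_neq0.
  apply; first by rewrite divr_gt0.
    by rewrite divr_ge0 ?(mulr_ge0 _ D0) ?sqr_ge0.
  by rewrite exprMn exprVn mulrC mulrA ler_wpM2r // invr_ge0 sqr_ge0.
have cv0 : 0 < cv by rewrite divr_gt0 ?mulr_gt0 ?c288 ?exprn_gt0.
have hV' : cv * V' <= cv * V - 2 * Cv * V + s * r / 144 * S + s / L ^+ 2 / 36 * E.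
  apply: le_trans (ler_wpM2l (ltW cv0) hV) _; rewrite le_eqVlt; apply/orP; left.
  apply/eqP; have -> : u / 2 = 1 - s / 2 by lra.
  by rewrite /cv /Cv; field; rewrite ?s_neq0 ?u_neq0 ?L_neq0.
have sr0 : 0 <= s * r by rewrite mulr_ge0 // ltW.
(* Uses the bound on [X'] with absolute constants, so no power of [1 / s] appears. *)
have hS' : s * r / 144 * S <= s * r / 144 * (46 / 5 * X + 41 / 5 * D + 18 * E).
  by apply: ler_wpM2l; [rewrite divr_ge0 ?ler0n | lra].
have hI0' : n^-1 * I0 <= n^-1 * (- a * (lo / 4 - a * (L * hi ^+ 2 / 8 + L * Gm ^+ 2 / 2)) * N).
  by rewrite ler_wpM2l // invr_ge0 ltW.
(* [K] bounds the total coefficient of [D]; together with the [L Gm^2 / 2] part of [I0] it amounts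
   to [Cnet / n]. *)
pose K := L / 2 * n^-1 + 2 * L ^+ 2 / (n ^+ 2 * s)
   + 288 * u * L ^+ 2 / (n ^+ 2 * s ^+ 3) + 2 * r * (u / s) + 7 / 24 * (s * r).
have K0 : 0 <= K.
  rewrite /K !addr_ge0 // ?mulr_ge0 ?invr_ge0 ?(ltW k0) ?mulr_ge0 ?(ltW c288) ?exprn_ge0 //;
  by rewrite ?(ltW L0) ?(ltW n0) ?(ltW s0) ?(ltW uE').
have DK : K * D <= K * (a ^+ 2 * Gm ^+ 2 * N) by rewrite ler_wpM2l.
have CfE : Cf * N =
    - (n^-1 * (- a * (lo / 4 - a * (L * hi ^+ 2 / 8 + L * Gm ^+ 2 / 2)) * N))
    - K * (a ^+ 2 * Gm ^+ 2 * N).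
  by rewrite /Cf /Cnet /K; field; rewrite ?n_neq0 ?s_neq0.
have -> : s * (1 + 3 * r * L ^+ 2) / (24 * L ^+ 2) = s / L ^+ 2 / 24 + s * r / 8.
  by field.
have w1 : 0 <= s / L ^+ 2 * E by rewrite mulr_ge0 // ltW.
have w2 : 0 <= s * r * X by rewrite mulr_ge0.
have w3 : 0 <= s * r * D by rewrite mulr_ge0.
have -> : Cx * X = 3 / 8 * s * X - s * r / 4 * X by rewrite /Cx; field.
have hX1 : X' <= X - s / 2 * X + u / s * (2 * r * D + 8 * E).
  by apply: le_trans hX _; rewrite le_eqVlt uE sE; apply/orP; left; apply/eqP; field.
rewrite CfE; move: DK; rewrite /K.
(* Naming the remaining quotients makes the goal linear. *)
move: hX1 hV' hS' hI0' hF young1 young2; clear -w1 w2 w3.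
move: (u / s) (s / L ^+ 2) w1 (288 * u * _ / _) (2 * L ^+ 2 / _) => k w w1 k2 k1.
move: (n^-1 * (- a * _ * N)) (a ^+ 2 * _ * N) => I0N DN.
lra.
Qed.

End Scalar.

(** * One iteration of AdaDQN *)

Section AdaDQN.
Variables (R : realType) (n p : nat).
Variables (f : 'I_n -> 'cV[R]_p -> R) (e : rel 'I_n) (W : 'M[R]_n).
Variables (L sigma : R) (q : adadqn_params R).
Hypotheses (n_gt0 : (0 < n)%N)
  (f_diff : forall i z, differentiable (f i) z)
  (L_gt0 : 0 < L)
  (grad_lipschitz : forall i z w,
     l2norm (gradient (f i) z - gradient (f i) w) <= L * l2norm (z - w))
  (W_sym : W^T = W) (W_dstoch : doubly_stochastic W)
  (W_eq0 : forall i j, j \notin neighbors e i -> W i j = 0)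
  (sigma_def : second_largest_eigenvalue_magnitude W sigma)
  (sigma_gt0 : 0 < sigma) (sigma_lt1 : sigma < 1)
  (Kc_ge1 : (1 <= q_Kc q)%N)
  (l_gt0 : 0 < q_lbound_eig q) (varrho_gt0 : 0 < q_varrho q)
  (gamma_gt0 : 0 < q_gamma q)
  (eta_ge0 : forall t, 0 <= q_eta q t) (tau_ge0 : forall s, 0 <= q_tau q s)
  (alpha_gt0 : 0 < q_alpha q)
  (alpha_Gamma : 2 * q_alpha q * Gamma q * L <= 1)
  (alpha_Psi : q_alpha q * L * Psi q ^+ 2 <= psi q L).

Let N_gt0 : 0 < n%:R :> R.
Proof. by rewrite ltr0n. Qed.

Let rho := sigma ^+ q_Kc q.

Let rho_ge0 : 0 <= rho.
Proof. by rewrite exprn_ge0 // ltW. Qed.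

Let rho_lt1 : rho < 1.
Proof. by rewrite expr_lt1 // ltW. Qed.

Let rE : sigma ^+ (2 * q_Kc q) = rho ^+ 2.
Proof. by rewrite mulnC exprM. Qed.

Let trigger_ge0 : 0 <= trigger_sum q sigma.
Proof. by apply: sumr_ge0 => k _; rewrite mulr_ge0 // exprn_ge0 // ltW. Qed.

Definition trigger_error t := Num.sqrt n%:R * q_eta q t * trigger_sum q sigma.

Lemma trigger_error_ge0 t : 0 <= trigger_error t.
Proof. by rewrite !mulr_ge0 ?sqrtr_ge0. Qed.

Lemma average_etc t (u : 'I_n -> 'cV[R]_p) : average (etc e W q t u) = average u.
Proof.
by have [] := etc_rounds_deviation n_gt0 W_sym W_dstoch sigma_def (ltW sigma_gt0)
  sigma_lt1 W_eq0 (eta_ge0 t) tau_ge0 u (q_Kc q).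
Qed.

Lemma deviation_etc t (u w : 'I_n -> 'cV[R]_p) :
  l2norm (stack (deviation (etc e W q t (fun i => u i + w i)))) <=
  rho * (l2norm (stack (deviation u)) + l2norm (stack w)) + 2 * trigger_error t.
Proof.
have [_] := etc_rounds_deviation n_gt0 W_sym W_dstoch sigma_def (ltW sigma_gt0)
  sigma_lt1 W_eq0 (eta_ge0 t) tau_ge0 (fun i => u i + w i) (q_Kc q).
rewrite -/(etc _ _ _ _ _) -/rho -/(trigger_sum q sigma) -mulrA -/(trigger_error t).
move/le_trans; apply; rewrite lerD2r ler_wpM2l //.
rewrite (eq_stack (deviationD u w)) stackD; apply: le_trans (l2normD _ _) _.
by rewrite lerD2l l2norm_deviation_le.
Qed.

(** The second clause is the gradient-tracking identity, linking the local directions to the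
    gradient in the descent of [F]. *)
Definition network_invariant (S : 'I_n -> node_state R p) :=
  (forall i, well_conditioned q L (hess (S i))) /\
  average (fun i => dir (S i)) = average (fun i => gradient (f i) (pos (S i))).

Section Step.
Variables (t : nat) (S : 'I_n -> node_state R p).
Hypothesis S_inv : network_invariant S.

Let x i := pos (S i).
Let v i := dir (S i).
Let x' i := pos (adadqn_step q f e W t S i).
Let v' i := dir (adadqn_step q f e W t S i).

Let d i := l2norm (pos (S i) - \sum_(j in neighbors e i) W i j *: pos (S j)).
Let loc i := iter (q_Kg q).-1 (local_step q (f i) (d i) (S i)) (S i).
Let dx i := pos (loc i) - q_alpha q *: (hess (loc i) *m dir (loc i)) - x i.
Let dg i := gradient (f i) (x' i) - gradient (f i) (x i).

Let loc_inv i : local_invariant q L (f i) (S i) (loc i).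
Proof.
by apply: local_invariant_iter => //; have [] := S_inv.
Qed.

Let dx_bounds i : l2norm (dx i) <= q_alpha q * Gamma q * l2norm (v i) /\
  dot (v i) (dx i) <= - q_alpha q * (psi q L / 4
    - q_alpha q * (L * Psi q ^+ 2 / 8 + L * Gamma q ^+ 2 / 2)) * dot (v i) (v i).
Proof. by apply: (mandatory_step _ _ _ _ _ _ _ _ (loc_inv i)). Qed.

Lemma pos_stepE : x' = etc e W q t (fun i => x i + dx i).
Proof.
by rewrite /x' /=; congr etc; apply/funext => i; rewrite /dx [RHS]addrC subrK.
Qed.

(** [dir - gradient] is constant in the local phase, so the intermediate gradients telescope to
    [dg]. *)
Lemma dir_stepE : v' = etc e W q t (fun i => v i + dg i).
Proof.
transitivity (etc e W q t (fun i =>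
  dir (loc i) + gradient (f i) (x' i) - gradient (f i) (pos (loc i)))); first by [].
congr etc; apply/funext => i.
have dirE : dir (loc i) = gradient (f i) (pos (loc i)) + (v i - gradient (f i) (x i)).
  by have [] := loc_inv i.
rewrite dirE /dg; move: (gradient _ (pos _)) (gradient _ (x i)) (gradient _ _) => a b c.
by apply/colP => k; rewrite !mxE; ring.
Qed.

Lemma average_dx : average x' - average x = average dx.
Proof. by rewrite pos_stepE average_etc averageD addrAC subrr add0r. Qed.

Lemma network_invariant_step : network_invariant (adadqn_step q f e W t S).
Proof.
split=> [i|]; last first.
  have [_ S_avg] := S_inv.
  rewrite -/v' dir_stepE average_etc averageD averageB S_avg.
  by rewrite addrC subrK.
by move=> z; apply: mbfgs_bounds.
Qed.

Let X := l2norm (stack (deviation x)).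
Let V := l2norm (stack (deviation v)).
Let D := l2norm (stack dx).

Lemma dx_le : D ^+ 2 <= q_alpha q ^+ 2 * Gamma q ^+ 2 * l2norm (stack v) ^+ 2.
Proof.
rewrite !sqr_l2norm_stack mulr_sumr -exprMn; apply: ler_sum => i _.
have [h _] := dx_bounds i.
by rewrite -exprMn lerXn2r ?nnegrE ?l2norm_ge0 // (le_trans _ h) ?l2norm_ge0.
Qed.

(** Pythagoras: the mean moves by the average displacement, while the deviation part is a difference
    of two consensus errors. *)
Lemma pos_step_le : l2norm (stack (fun i => x' i - x i)) ^+ 2 <=
  D ^+ 2 + 2 * X ^+ 2 + 2 * l2norm (stack (deviation x')) ^+ 2.
Proof.
rewrite (sqr_l2norm_stack_average n_gt0) averageB average_dx.
rewrite (eq_stack (deviationB x' x)) stackB -/X.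
have := average_sqr_le n_gt0 dx; rewrite -/D.
have := l2normB (stack (deviation x')) (stack (deviation x)); rewrite -/X.
set y := l2norm (_ - _); set z := l2norm (stack (deviation x')) => h1.
have : y ^+ 2 <= (z + X) ^+ 2.
  by rewrite lerXn2r ?nnegrE ?addr_ge0 ?l2norm_ge0.
have := sqr_ge0 (z - X); lra.
Qed.

Lemma dg_le : l2norm (stack dg) ^+ 2 <=
  L ^+ 2 * l2norm (stack (fun i => x' i - x i)) ^+ 2.
Proof.
rewrite !sqr_l2norm_stack mulr_sumr; apply: ler_sum => i _.
have h := grad_lipschitz i (x' i) (x i).
by rewrite -exprMn lerXn2r ?nnegrE ?l2norm_ge0 // (le_trans _ h) ?l2norm_ge0.
Qed.

Let I0 := \sum_i dot (v i) (dx i).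
Let I1 := \sum_i dot (average v - v i) (dx i).
Let I2 := \sum_i dot (gradient (f i) (average x) - gradient (f i) (x i)) (average dx).

(** Gradient tracking turns [I0 + I1] into a sum of local gradients at the [x i]; [I2] moves them to
    the mean, where the descent lemma applies. *)
Lemma average_fun_step : average_fun f (average x') <=
  average_fun f (average x) + n%:R^-1 * (I0 + I1 + I2) + L / 2 * (n%:R^-1 * D ^+ 2).
Proof.
set dl := average dx.
have I_sum : I0 + I1 + I2 = \sum_i dot (gradient (f i) (average x)) dl.
  have -> : I0 + I1 = \sum_i dot (gradient (f i) (x i)) dl.
    rewrite /I0 /I1 -big_split /=.
    under eq_bigr => i _ do rewrite -dotDl addrC subrK.
    rewrite -dot_sumr (sum_average n_gt0) -/dl dotZr -dotZl.
    have [_ S_avg] := S_inv; rewrite S_avg -(sum_average n_gt0) dotC dot_sumr.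
    by apply: eq_bigr => i _; rewrite dotC.
  by rewrite /I2 -big_split; apply: eq_bigr => i _ /=; rewrite dotBl addrC subrK.
have dl2 : dot dl dl <= n%:R^-1 * D ^+ 2.
  by rewrite mulrC ler_pdivlMr // mulrC average_sqr_le.
have : average_fun f (average x') <=
    average_fun f (average x) + n%:R^-1 * (I0 + I1 + I2) + L / 2 * dot dl dl.
  rewrite I_sum /average_fun -mulrDr.
  have -> : L / 2 * dot dl dl = n%:R^-1 * \sum_(i < n) (L / 2 * dot dl dl).
    by rewrite sumr_const card_ord -[(L / 2 * dot dl dl) *+ n]mulr_natl mulKf ?gt_eqF.
  rewrite -mulrDr ler_wpM2l ?invr_ge0 // -!big_split; apply: ler_sum => i _ /=.
  have := lipschitz_gradient_bound (f_diff i) (@grad_lipschitz i) (average x) (average x').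
  by rewrite average_dx -/dl ler_norml => /andP[_]; lra.
have : L / 2 * dot dl dl <= L / 2 * (n%:R^-1 * D ^+ 2).
  by rewrite ler_wpM2l // divr_ge0 // ltW.
lra.
Qed.

Lemma I0_le : I0 <= - q_alpha q * (psi q L / 4
    - q_alpha q * (L * Psi q ^+ 2 / 8 + L * Gamma q ^+ 2 / 2)) * l2norm (stack v) ^+ 2.
Proof.
rewrite sqr_l2norm dot_stack mulr_sumr; apply: ler_sum => i _.
by have [] := dx_bounds i.
Qed.

Lemma I1_le : I1 ^+ 2 <= V ^+ 2 * D ^+ 2.
Proof.
apply: le_trans (cauchy_schwarz_sum _ _) _; rewrite /V /D !sqr_l2norm !dot_stack.
rewrite le_eqVlt; apply/orP; left; apply/eqP; congr (_ * _); apply: eq_bigr => i _.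
by rewrite /deviation -[average v - v i]opprB dotNl dotNr opprK.
Qed.

Lemma I2_le : I2 ^+ 2 <= X ^+ 2 * (L ^+ 2 * D ^+ 2).
Proof.
apply: le_trans (cauchy_schwarz_sum _ _) _; rewrite mulrA (mulrC (X ^+ 2)).
apply: ler_pM; first by apply: sumr_ge0 => i _; exact: dotvv_ge0.
- by apply: sumr_ge0 => i _; exact: dotvv_ge0.
- rewrite /X sqr_l2norm_stack mulr_sumr; apply: ler_sum => i _.
  have h := grad_lipschitz i (average x) (x i).
  rewrite /deviation l2norm_distC -exprMn -sqr_l2norm.
  by rewrite lerXn2r ?nnegrE ?l2norm_ge0 // (le_trans _ h) ?l2norm_ge0.
- by rewrite sumr_const card_ord -mulr_natl average_sqr_le.
Qed.

Lemma potential_step :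
  potential q f L sigma x' v' <= potential q f L sigma x v
  - (C_f n q L sigma * l2norm (stack v) ^+ 2 + C_v q L sigma * V ^+ 2
     + C_x q sigma * X ^+ 2)
  + (theta1 n q sigma + theta2 n q L sigma) * q_eta q t ^+ 2.
Proof.
have x'_le := deviation_etc t x dx; rewrite -pos_stepE -/X -/D in x'_le.
have v'_le := deviation_etc t v dg; rewrite -dir_stepE -/V in v'_le.
have [hX hX'] := contraction_sqr_le rho_ge0 rho_lt1 (l2norm_ge0 _) (l2norm_ge0 _)
  (trigger_error_ge0 t) (l2norm_ge0 _) x'_le.
have [hV _] := contraction_sqr_le rho_ge0 rho_lt1 (l2norm_ge0 _) (l2norm_ge0 _)
  (trigger_error_ge0 t) (l2norm_ge0 _) v'_le.
have r_lt1 : rho ^+ 2 < 1 by rewrite expr_lt1.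
have hV2 : l2norm (stack (deviation v')) ^+ 2 <=
    (1 + rho ^+ 2) / 2 * V ^+ 2 + (1 + rho ^+ 2) / (1 - rho ^+ 2) *
    (2 * rho ^+ 2 * (L ^+ 2 * l2norm (stack (fun i => x' i - x i)) ^+ 2)
     + 8 * trigger_error t ^+ 2).
  apply: le_trans hV _; rewrite lerD2l ler_wpM2l //.
    by rewrite divr_ge0 ?subr_ge0 ?(ltW r_lt1) // addr_ge0 ?sqr_ge0.
  by rewrite lerD2r ler_wpM2l ?dg_le // mulr_ge0 // sqr_ge0.
have := potential_decrease N_gt0 (sqr_ge0 _) r_lt1 L_gt0 alpha_gt0 (sqr_ge0 _)
  (sqr_ge0 _) (sqr_ge0 _) (sqr_ge0 _) (sqr_ge0 _) dx_le hX hX' pos_step_le hV2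
  average_fun_step I0_le I1_le I2_le.
rewrite /potential !stack_deviation /C_f /C_v /C_x /theta1 /theta2 /C_net !rE.
have -> : trigger_error t ^+ 2 = n%:R * q_eta q t ^+ 2 * trigger_sum q sigma ^+ 2.
  by rewrite /trigger_error !exprMn sqr_sqrtr.
cbv zeta => /le_trans; apply; rewrite le_eqVlt; apply/orP; left; apply/eqP.
congr (_ + _ + _ - _ + _).
ring.
Qed.

End Step.
End AdaDQN.

(** * Telescoping and the final rate *)

Lemma telescope_le (R : realDomainType) (P E h : nat -> R) (C c : R) :
  (forall t, P t.+1 + C * E t <= P t + c * h t) ->
  forall T, P T + C * \sum_(0 <= t < T) E t <= P 0%N + c * \sum_(0 <= t < T) h t.
Proof.
move=> Pstep; elim=> [|T IH]; first by rewrite !big_geq // !mulr0 !addr0.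
by rewrite !big_nat_recr //= !mulrDr; have := Pstep T; lra.
Qed.

Lemma bigmin_mean_le (R : realDomainType) (E : nat -> R) (c : R) (T : nat) :
  T%:R * \big[Num.min/c]_(0 <= t < T) E t <= \sum_(0 <= t < T) E t.
Proof.
rewrite mulr_natl -[X in _ *+ X]subn0 -sumr_const_nat.
apply: ler_sum_nat => t t_lt.
by apply: ge_bigmin_seq; rewrite ?mem_index_iota.
Qed.

Theorem theorem4p6 (R : realType) (n p : nat)
    (f : 'I_n -> 'cV[R]_p -> R) (e : rel 'I_n) (W : 'M[R]_n)
    (L sigma : R) (q : adadqn_params R) (x0 : 'I_n -> 'cV[R]_p)
    (f_diff : forall i z, differentiable (f i) z)
    (f_C1 : forall i, continuous (gradient (f i)))
    (F_bounded_below : has_lbound (range (average_fun f)))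
    (L_gt0 : 0 < L)
    (grad_lipschitz : forall i z w,
       l2norm (gradient (f i) z - gradient (f i) w) <= L * l2norm (z - w))
    (e_sym : symmetric e)
    (e_connected : forall i j, connect e i j)
    (W_sym : W^T = W)
    (W_dstoch : doubly_stochastic W)
    (W_gt0 : forall i j, j \in neighbors e i -> 0 < W i j)
    (W_eq0 : forall i j, j \notin neighbors e i -> W i j = 0)
    (sigma_def : second_largest_eigenvalue_magnitude W sigma)
    (sigma_gt0 : 0 < sigma) (sigma_lt1 : sigma < 1)
    (Kg_ge1 : (1 <= q_Kg q)%N) (Kc_ge1 : (1 <= q_Kc q)%N)
    (l_gt0 : 0 < q_lbound_eig q) (l_le_u : q_lbound_eig q <= q_ubound_eig q)
    (varrho_gt0 : 0 < q_varrho q)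
    (eps_tilde_gt0 : 0 < q_eps_tilde q) (eps_gt : q_eps_tilde q < q_eps q)
    (gamma_gt0 : 0 < q_gamma q)
    (eta_ge0 : forall t, 0 <= q_eta q t)
    (eta_noninc : forall t1 t2, (t1 <= t2)%N -> q_eta q t2 <= q_eta q t1)
    (tau_ge0 : forall s, 0 <= q_tau q s)
    (tau_noninc : forall s1 s2, (s1 <= s2)%N -> q_tau q s2 <= q_tau q s1)
    (eta_summable : (\sum_(0 <= t <oo) (q_eta q t ^+ 2)%:E < +oo)%E)
    (alpha_gt0 : 0 < q_alpha q)
    (alpha_le : q_alpha q <=
       Num.min (1 / (2 * Gamma q * L))
         (Num.min (psi q L / (L * Psi q ^+ 2))
                  (psi q L / (16 * Gamma q ^+ 2 * C_net n q L sigma)))) :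
  let x t i := pos (adadqn q f e W x0 t i) in
  let v t i := dir (adadqn q f e W x0 t i) in
  let E t := stationarity_measure (x t) (v t) in
  0 < C_hat n q L sigma /\
  forall T : nat, (1 <= T)%N ->
    (* starting the iterated minimum from [E 0] is harmless since T >= 1 *)
    \big[Num.min/E 0%N]_(0 <= t < T) E t <=
    (potential q f L sigma (x 0%N) (v 0%N) - inf (range (average_fun f))
     + Theta n q L sigma T) / (C_hat n q L sigma * T%:R).
Proof.
move=> x v E.
(* For [n = 0] the eigenvalue list is empty and the default entry gives [sigma = 0]. *)
have n_gt0 : (0 < n)%N.
  rewrite lt0n; apply/eqP => n0; have [s [Ws sigmaE]] := sigma_def.
  have /(congr1 (fun P : {poly R} => size P)) := Ws.
  rewrite size_char_poly size_prod_XsubC n0 => -[s0].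
  move: sigma_gt0; rewrite sigmaE nth_default ?ltxx //.
  by rewrite size_sort size_map -s0.
have N_gt0 : 0 < n%:R :> R by rewrite ltr0n.
set ps := psi q L; set Ps := Psi q; set G := Gamma q; set a := q_alpha q.
set r := sigma ^+ (2 * q_Kc q).
have r0 : 0 <= r by rewrite exprn_ge0 // ltW.
have r1 : r < 1 by rewrite expr_lt1 ?(ltW sigma_gt0) // muln_gt0.
have Ps1 : 1 <= Ps by exact: Psi_ge1.
have G0 : 0 < G by rewrite addr_gt0 // mulr_gt0 // (lt_le_trans _ Ps1).
have ps0 : 0 < ps by exact: psi_gt0.
have ps1 : ps <= 1 by exact: psi_le1.
have s0 : 0 < 1 - r by rewrite subr_gt0.
have c288 : 0 < 288 :> R by rewrite ltr0n.
have c1152 : 0 < 1152 :> R by rewrite ltr0n.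
have u0 : 0 < 1 + r by rewrite ltr_wpDr.
have Cnet0 : 0 < C_net n q L sigma.
  rewrite /C_net -/r; apply: ltr_wpDr.
    by rewrite !mulr_ge0 ?(ltW s0) ?invr_ge0 ?ler0n.
  apply: ltr_wpDr.
    by rewrite !mulr_ge0 ?(ltW u0) ?invr_ge0 ?(ltW s0) ?ler0n.
  apply: ltr_wpDr.
    apply: divr_ge0; first exact: mulr_ge0 (mulr_ge0 (ltW c288) (ltW u0)) (sqr_ge0 L).
    exact: mulr_ge0 (ltW N_gt0) (exprn_ge0 3 (ltW s0)).
  apply: ltr_wpDr => //.
  exact: divr_ge0 (mulr_ge0 (ler0n _ _) (sqr_ge0 L)) (mulr_ge0 (ltW N_gt0) (ltW s0)).
move: alpha_le; rewrite !le_min -/a -/ps -/Ps -/G => /and3P[a1 a2 a3].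
have aG : 2 * a * G * L <= 1.
  by move: a1; rewrite ler_pdivlMr ?mulr_gt0 //; lra.
have aP : a * L * Ps ^+ 2 <= ps.
  by move: a2; rewrite ler_pdivlMr ?mulr_gt0 ?exprn_gt0 ?(lt_le_trans _ Ps1) // mulrA.
have aC : a * (G ^+ 2 * C_net n q L sigma) <= ps / 16.
  move: a3; rewrite ler_pdivlMr ?mulr_gt0 ?exprn_gt0 //; lra.
(* The bracket is at least [psi (1/4 - 1/8 - 1/16) = psi / 16]. *)
have Cf0 : 0 < C_f n q L sigma.
  by rewrite /C_f -/a -/ps -/Ps -/G mulr_gt0 ?divr_gt0 //; lra.
have Cx0 : 0 < C_x q sigma by rewrite /C_x -/r divr_gt0 // mulr_gt0 //; lra.
have Cv0 : 0 < C_v q L sigma.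
  by rewrite /C_v -/r divr_gt0 ?mulr_gt0 ?c1152 ?exprn_gt0.
have C0 : 0 < C_hat n q L sigma by rewrite /C_hat !lt_min Cf0 Cx0 Cv0.
split=> // T T_ge1.
have inv t : network_invariant f L q (adadqn q f e W x0 t).
  elim: t => [|t IH]; last first.
    exact: (network_invariant_step n_gt0 f_diff L_gt0 grad_lipschitz W_sym W_dstoch
      W_eq0 sigma_def sigma_gt0 sigma_lt1 l_gt0 varrho_gt0 gamma_gt0 eta_ge0 tau_ge0
      alpha_gt0 aG aP t IH).
  split=> [i z|//] /=; rewrite mul1mx; split.
    by rewrite ler_piMl ?dotvv_ge0.
  by rewrite ler_peMl ?l2norm_ge0.
have step t : potential q f L sigma (x t.+1) (v t.+1) + C_hat n q L sigma * E t <=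
    potential q f L sigma (x t) (v t)
    + (theta1 n q sigma + theta2 n q L sigma) * q_eta q t ^+ 2.
  have := potential_step n_gt0 f_diff L_gt0 grad_lipschitz W_sym W_dstoch W_eq0
    sigma_def sigma_gt0 sigma_lt1 Kc_ge1 l_gt0 varrho_gt0 gamma_gt0 eta_ge0 tau_ge0
    alpha_gt0 aG aP t (inv t).
  rewrite -/(x t) -/(v t) -/(x t.+1) -/(v t.+1).
  rewrite /E /stationarity_measure !stack_deviation.
  have Cf_le : C_hat n q L sigma <= C_f n q L sigma by rewrite ge_min lexx.
  have Cx_le : C_hat n q L sigma <= C_x q sigma by rewrite !ge_min lexx orbT.
  have Cv_le : C_hat n q L sigma <= C_v q L sigma by rewrite !ge_min lexx !orbT.
  have := ler_wpM2r (sqr_ge0 (l2norm (stack (v t)))) Cf_le.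
  have := ler_wpM2r (sqr_ge0 (l2norm (stack (deviation (v t))))) Cv_le.
  have := ler_wpM2r (sqr_ge0 (l2norm (stack (deviation (x t))))) Cx_le.
  lra.
pose P t := potential q f L sigma (x t) (v t).
have := @telescope_le _ P _ _ _ _ step T; rewrite -/(Theta n q L sigma T) /P => total.
(* The other two terms of the potential are nonnegative, so it dominates [F] at the mean. *)
have F_le : inf (range (average_fun f)) <= potential q f L sigma (x T) (v T).
  rewrite /potential -/r -addrA; apply: ler_wpDr.
    rewrite addr_ge0 ?sqr_ge0 // mulr_ge0 ?sqr_ge0 // divr_ge0 ?sqr_ge0 //.
    by rewrite !mulr_ge0 ?(ltW c288) ?(ltW u0) ?exprn_ge0 ?(ltW L_gt0).
  by apply: ge_inf => //; exists (average (x T)).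
rewrite ler_pdivlMr ?mulr_gt0 ?ltr0n // mulrCA.
have := ler_wpM2l (ltW C0) (bigmin_mean_le E (E 0%N) T).
rewrite [_ * T%:R]mulrC; lra.
Qed.
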